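(* For each integer $m>1$, the smooth manifold underlying $SL(2m-1,\mathbb{C})$ admits homogeneous (i.e. left invariant) hypercomplex structures.
   Context: A complex structure on a smooth manifold $M$ is a smooth fibrewise linear map $J:TM\to TM$ with $J^2=-\mathrm{Id}$ which is integrable, i.e. $[J(X),J(Y)]-[X,Y]-J([J(X),Y])-J([X,J(Y)])=0$ for all vector fields $X,Y$ on $M$. A hypercomplex structure on $M$ is a pair $(J_1,J_2)$ of complex structures on $M$ with $J_1J_2=-J_2J_1$. A hypercomplex structure on a Lie group $G$, regarded as a real manifold, is homogeneous, or left invariant, if all left translations of $G$ preserve $J_1$ and $J_2$. Here $SL(2m-1,\mathbb{C})$ is regarded as a real smooth manifold and a real Lie group. *)

(* Defs.v *)
From HB Require Import structures.
From mathcomp Require Import all_boot all_order all_algebra.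
From mathcomp Require Import all_classical all_reals all_analysis.
From mathcomp Require Import complex.
Set Implicit Arguments.
Unset Strict Implicit.
Unset Printing Implicit Defensive.
Import Order.TTheory GRing.Theory Num.Theory.
Import numFieldNormedType.Exports.
Local Open Scope classical_set_scope.
Local Open Scope ring_scope.

(* Smooth manifolds are handled as embedded submanifolds M of a
   finite-dimensional real normed space V, with the induced smooth structure. *)

(* f is C^k on the open set U; in finite dimension, the directional
   derivatives 'D_v f being C^k is the same as the differential being C^k. *)
Fixpoint Ck_on_open (R : realType) (V W : normedModType R)
    (k : nat) (U : set V) (f : V -> W) : Prop :=
  match k with
  | 0 => forall x, U x -> {for x, continuous f}
  | k'.+1 => (forall x, U x -> differentiable f x) /\
             (forall v : V, Ck_on_open k' U (fun x => 'D_v f x))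
  end.

Definition smooth_on_open (R : realType) (V W : normedModType R)
    (U : set V) (f : V -> W) : Prop :=
  open U /\ forall k, Ck_on_open k U f.

Definition local_extension (R : realType) (V W : normedModType R)
    (M : set V) (f : V -> W) (p : V) (F : V -> W) : Prop :=
  exists U : set V,
    [/\ U p, smooth_on_open U F & forall q, U q -> M q -> F q = f q].

(* The values of f outside M are irrelevant. *)
Definition smooth_on (R : realType) (V W : normedModType R)
    (M : set V) (f : V -> W) : Prop :=
  forall p, M p -> exists F, local_extension M f p F.

Definition tangent (R : realType) (V : normedModType R)
    (M : set V) (p v : V) : Prop :=
  exists (c : R^o -> V) (I : set R^o),
    [/\ I 0, smooth_on_open I c, forall t, I t -> M (c t), c 0 = p
      & 'D_1 c 0 = v].

Definition tangent_bundle (R : realType) (V : normedModType R) (M : set V) :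
    set (V * V)%type :=
  [set x | M x.1 /\ tangent M x.1 x.2].

(* The differential df_p(v) of a map f smooth on M, at p in M and v tangent
   to M at p: the derivative along v of a smooth local extension of f.  All
   extensions give the same value, because v is the velocity of a curve in M. *)
Definition tdiff (R : realType) (V W : normedModType R)
    (M : set V) (f : V -> W) (p v : V) : W :=
  xget 0 [set w | exists2 F, local_extension M f p F & 'D_v F p = w].

Definition vector_field (R : realType) (V : normedModType R)
    (M : set V) (X : V -> V) : Prop :=
  smooth_on M X /\ forall p, M p -> tangent M p (X p).

Definition lie_bracket (R : realType) (V : normedModType R)
    (M : set V) (X Y : V -> V) : V -> V :=
  fun p => tdiff M Y p (X p) - tdiff M X p (Y p).

(* A fibrewise map J : TM -> TM over the identity of M is given by its
   fibres J p : T_p M -> T_p M. *)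
Definition bundle_endomorphism (R : realType) (V : normedModType R)
    (M : set V) (J : V -> V -> V) : Prop :=
  [/\ forall p v, M p -> tangent M p v -> tangent M p (J p v),
      forall p (a : R) u v, M p -> tangent M p u -> tangent M p v ->
        J p (a *: u + v) = a *: J p u + J p v
    & smooth_on (tangent_bundle M) (fun x => (x.1, J x.1 x.2))].

Definition integrable_structure (R : realType) (V : normedModType R)
    (M : set V) (J : V -> V -> V) : Prop :=
  forall X Y : V -> V, vector_field M X -> vector_field M Y ->
  let JX := fun p => J p (X p) in
  let JY := fun p => J p (Y p) in
  forall p, M p ->
    lie_bracket M JX JY p - lie_bracket M X Y p
      - J p (lie_bracket M JX Y p) - J p (lie_bracket M X JY p) = 0.

Definition complex_structure (R : realType) (V : normedModType R)
    (M : set V) (J : V -> V -> V) : Prop :=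
  [/\ bundle_endomorphism M J,
      forall p v, M p -> tangent M p v -> J p (J p v) = - v
    & integrable_structure M J].

Definition hypercomplex_structure (R : realType) (V : normedModType R)
    (M : set V) (J1 J2 : V -> V -> V) : Prop :=
  [/\ complex_structure M J1, complex_structure M J2
    & forall p v, M p -> tangent M p v -> J1 p (J2 p v) = - J2 p (J1 p v)].

(* The differential of each left translation intertwines J with itself. *)
Definition left_invariant (R : realType) (V : normedModType R)
    (G : set V) (mul : V -> V -> V) (J : V -> V -> V) : Prop :=
  forall g p v, G g -> G p -> tangent G p v ->
    tdiff G (mul g) p (J p v) = J (mul g p) (tdiff G (mul g) p v).

Definition homogeneous_hypercomplex_structure
    (R : realType) (V : normedModType R)
    (G : set V) (mul : V -> V -> V) (J1 J2 : V -> V -> V) : Prop :=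
  [/\ hypercomplex_structure G J1 J2,
      left_invariant G mul J1 & left_invariant G mul J2].

(* Complex n x n matrices as a real normed space: the pair (A, B) of real
   matrices stands for A + i B. *)
Definition to_complex (R : realType) (n : nat)
    (x : 'M[R]_n * 'M[R]_n) : 'M[R[i]]_n :=
  \matrix_(i, j) Complex (x.1 i j) (x.2 i j).

Definition of_complex (R : realType) (n : nat)
    (A : 'M[R[i]]_n) : 'M[R]_n * 'M[R]_n :=
  (map_mx (@complex.Re R) A, map_mx (@complex.Im R) A).

Definition cmul (R : realType) (n : nat)
    (x y : 'M[R]_n * 'M[R]_n) : 'M[R]_n * 'M[R]_n :=
  of_complex (to_complex x *m to_complex y).

(* det is a submersion along this set, so it is a closed embedded
   submanifold of M_n(C). *)
Definition SLC (R : realType) (n : nat) : set ('M[R]_n * 'M[R]_n)%type :=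
  [set x | \det (to_complex x) = 1].

(* Main.v *)
(** Over C, a left-invariant C-linear hypercomplex structure on SL_n(C) is a pair
of anticommuting C-linear operators j1, j2 on sl_n(C) with square -1 and
vanishing Nijenhuis tensor. For n = 2k+1, group the indices 0, ..., n-1 into k
pairs {2l, 2l+1} followed by the last index alone, let T be the projection onto
block upper triangular matrices and e the last diagonal matrix unit. For a block
diagonal Q with Q^2 = e - 1 and Q e = e Q = 0, the operator
  j_Q(A) = Q T(A) - (A - T(A)) Q - tr(Q A) e
has square -1 on sl_n(C) and vanishing Nijenhuis tensor, and Q1 Q2 = - Q2 Q1
makes j_Q1 and j_Q2 anticommute; the two quaternion units diag(i, -i) and
[[0, 1], [-1, 0]], repeated along the pairs, provide such Q1 and Q2. This is
Joyce's construction in a complexified form. On the group, J p v =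
p j(p^-1 v), and writing vector fields as q |-> q xi(q) reduces integrability to
the vanishing of the Nijenhuis tensor of j. *)

Require Import Defs.
From HB Require Import structures.
From mathcomp Require Import all_boot all_order all_algebra all_fingroup.
From mathcomp Require Import all_classical all_reals all_analysis.
From mathcomp Require Import complex.
From mathcomp Require Import ring.
Set Implicit Arguments.
Unset Strict Implicit.
Unset Printing Implicit Defensive.
Import Order.TTheory GRing.Theory Num.Theory.
Import numFieldNormedType.Exports.
Local Open Scope classical_set_scope.
Local Open Scope ring_scope.

(** * Maps of class C^k *)

Section SmoothCalculus.
Context {R : realType} {E : normedModType R}.
Implicit Types (V W : normedModType R) (U : set E) (k : nat).

Lemma derive_comp_linear V W (L0 : V -> W) (f : E -> V) x v :
  linear L0 -> continuous L0 -> differentiable f x ->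
  differentiable (L0 \o f) x /\ 'D_v (L0 \o f) x = L0 ('D_v f x).
Proof.
move=> lL.
pose L : {linear V -> W} := HB.pack L0 (GRing.isLinear.Build _ _ _ _ _ lL).
rewrite -[L0]/(L : V -> W) => cL df.
have dL : differentiable L (f x) by exact: linear_differentiable.
split; first exact: differentiable_comp.
rewrite (deriveE _ df) deriveE; last exact: differentiable_comp.
by rewrite (diff_comp df dL) /= (diff_lin _ cL).
Qed.

Lemma Ck_on_openW V U (f : E -> V) k :
  Ck_on_open k.+1 U f -> Ck_on_open k U f.
Proof.
elim: k f => [|k IH] f /= [df Df].
  by move=> x Ux; exact/differentiable_continuous/df.
by split=> // v; exact: IH.
Qed.

(** The zero map serves as differential: near [x] the function is its own remainder and vanishes, so
    it is a little o of the increment. *)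
Lemma differentiable_near0 V (h : E -> V) x :
  (\near x, h x = 0) -> differentiable h x.
Proof.
move=> h0.
have H : continuous (0 : E -> V) /\ h \o shift x = cst (h x) + \0 +o_ 0 id.
  split; first exact: cst_continuous.
  apply/eqaddoP => e e0; rewrite (nbhs_singleton h0).
  move: h0; rewrite (near_shift 0) subr0 /=; apply: filterS => y /= hy.
  by rewrite !fctE /= hy addr0 subr0 normr0 mulr_ge0// ltW.
apply/diff_locallyP.
have dh : 'd h x = 0 :> (E -> V) by apply/diff_unique; case: H.
by rewrite dh.
Qed.

Lemma differentiable_near_eq V (f g : E -> V) x :
  (\near x, f x = g x) -> differentiable f x -> differentiable g x.
Proof.
move=> fg df; rewrite -[g](subrK f) addrC; apply: differentiableD => //.
apply: differentiable_near0; apply: filterS fg => y fgy.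
by rewrite -[LHS]/(g y - f y) fgy subrr.
Qed.

(** Openness turns equality on [U] into equality near each point, so the directional derivatives
    agree on [U] as well and the induction on [k] goes through. Later inductions use it to exchange
    a derivative for a formula valid on [U] only. *)
Lemma Ck_on_open_eq V U (f g : E -> V) k : open U ->
  (forall x, U x -> f x = g x) -> Ck_on_open k U f -> Ck_on_open k U g.
Proof.
move=> oU.
have near_U (f1 g1 : E -> V) x : (forall x, U x -> f1 x = g1 x) -> U x ->
    \near x, f1 x = g1 x.
  move=> fg Ux; apply: (filterS (P := U)) => //.
  exact: open_nbhs_nbhs.
elim: k f g => [|k IH] f g fg /=.
  move=> h x Ux; have fgx := near_U _ _ _ fg Ux.
  suff : g y @[y --> x] --> f x by rewrite (fg _ Ux).
  by apply: cvg_trans (h x Ux); exact: near_eq_cvg.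
move=> [df Df]; split=> [x Ux|v].
  exact: differentiable_near_eq (near_U _ _ _ fg Ux) (df _ Ux).
apply: IH (Df v) => x Ux; exact: near_eq_derive (near_U _ _ _ fg Ux).
Qed.

Lemma Ck_on_open_cst V U (a : V) k : Ck_on_open k U (cst a).
Proof.
elim: k a => [|k IH] a /=; first by move=> x _; exact: cst_continuous.
split=> [x _|v]; first exact: differentiable_cst.
by rewrite (_ : (fun x => _) = cst 0) //; apply/funext => x; rewrite derive_cst.
Qed.

Lemma Ck_on_openD V U (f g : E -> V) k : open U ->
  Ck_on_open k U f -> Ck_on_open k U g -> Ck_on_open k U (f \+ g).
Proof.
move=> oU; elim: k f g => [|k IH] f g /=.
  by move=> hf hg x Ux; apply: continuousD; [exact: hf|exact: hg].
move=> [df Df] [dg Dg]; split=> [x Ux|v].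
  by apply: differentiableD; [exact: df|exact: dg].
apply: (Ck_on_open_eq _ _ (IH _ _ (Df v) (Dg v))) => // x Ux /=.
by rewrite -deriveD//; apply: diff_derivable; [exact: df|exact: dg].
Qed.

Lemma Ck_on_open_sum V U (I : Type) (r : seq I) (P : pred I)
    (f : I -> E -> V) k : open U ->
  (forall i, P i -> Ck_on_open k U (f i)) ->
  Ck_on_open k U (fun x => \sum_(i <- r | P i) f i x).
Proof.
move=> oU hf; elim: r => [|i r IH].
  apply: Ck_on_open_eq (Ck_on_open_cst U 0 k) => // x _.
  by rewrite big_nil.
case: (boolP (P i)) => Pi.
  apply: (Ck_on_open_eq _ _ (Ck_on_openD _ (hf _ Pi) IH)) => // x _.
  by rewrite big_cons Pi.
by apply: (Ck_on_open_eq _ _ IH) => // x _; rewrite big_cons (negbTE Pi).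
Qed.

Lemma Ck_on_open_linear V W U (L : V -> W) (f : E -> V) k : open U ->
  linear L -> continuous L -> Ck_on_open k U f -> Ck_on_open k U (L \o f).
Proof.
move=> oU lL cL; elim: k f => [|k IH] f /=.
  by move=> hf x Ux; apply: continuous_comp; [exact: hf|exact: cL].
move=> [df Df]; split=> [x Ux|v].
  by have [] := derive_comp_linear 0 lL cL (df _ Ux).
apply: (Ck_on_open_eq _ _ (IH _ (Df v))) => // x Ux /=.
by have [_ ->] := derive_comp_linear v lL cL (df _ Ux).
Qed.

Lemma Ck_on_open_id U k : Ck_on_open k U (@id E).
Proof.
case: k => [|k] /=; first by move=> x _; exact: cvg_id.
split=> [x _|v]; first exact: ex_diff.
rewrite (_ : (fun x => _) = cst v); first exact: Ck_on_open_cst.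
by apply/funext => x; rewrite derive_id.
Qed.

Lemma Ck_on_openM U (f g : E -> R^o) k : open U ->
  Ck_on_open k U f -> Ck_on_open k U g -> Ck_on_open k U (fun x => f x * g x).
Proof.
move=> oU; elim: k f g => [|k IH] f g.
  by move=> hf hg x Ux; apply: continuousM; [exact: hf|exact: hg].
move=> hf hg; have [df Df] := hf; have [dg Dg] := hg; split=> [x Ux|v].
  by apply: differentiableM; [exact: df|exact: dg].
(* The Leibniz formula contains [f] and [g] themselves, which are lowered to class C^k to fit the
   induction hypothesis. *)
have hf' := Ck_on_openW hf; have hg' := Ck_on_openW hg.
apply: (Ck_on_open_eq _ _ (Ck_on_openD _ (IH _ _ hf' (Dg v))
  (IH _ _ hg' (Df v)))) => // x Ux /=.
by rewrite deriveM//; apply: diff_derivable; [exact: df|exact: dg].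
Qed.

Lemma Ck_on_openV U (f : E -> R^o) k : open U -> (forall x, U x -> f x != 0) ->
  Ck_on_open k U f -> Ck_on_open k U (fun x => (f x)^-1).
Proof.
move=> oU f0; elim: k f f0 => [|k IH] f f0.
  by move=> hf x Ux; apply: continuousV; [exact: f0|exact: hf].
move=> hf; have [df Df] := hf; split=> [x Ux|v].
  by apply: differentiableV; [exact: df|exact: f0].
have hV := IH _ f0 (Ck_on_openW hf).
(* The derivative of 1/f is (1/f)(1/f)(-f'), where 1/f is C^k by induction. *)
have hN := Ck_on_openM oU (Ck_on_open_cst U (-1 : R^o) k) (Df v).
apply: (Ck_on_open_eq _ _ (Ck_on_openM _ (Ck_on_openM _ hV hV) hN)) => // x Ux.
rewrite deriveV ?f0//; last exact/diff_derivable/df.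
by rewrite /= /cst mulN1r mulrN -invfM -expr2 scaleNr.
Qed.

Lemma Ck_on_open_pair V W U (f : E -> V) (g : E -> W) k : open U ->
  Ck_on_open k U f -> Ck_on_open k U g -> Ck_on_open k U (fun x => (f x, g x)).
Proof.
move=> oU; elim: k f g => [|k IH] f g /=.
  by move=> hf hg x Ux; apply: cvg_pair; [exact: hf|exact: hg].
move=> [df Df] [dg Dg]; split=> [x Ux|v].
  by apply: differentiable_pair; [exact: df|exact: dg].
apply: (Ck_on_open_eq _ _ (IH _ _ (Df v) (Dg v))) => // x Ux /=.
have dfx := df _ Ux; have dgx := dg _ Ux.
by rewrite !deriveE ?diff_pair//; exact: differentiable_pair.
Qed.

End SmoothCalculus.

(** * Complex-valued functions *)

Section ComplexCalculus.
Context {R : realType} {E : normedModType R}.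
Local Notation C := R[i].
Implicit Types (U : set E) (k : nat) (f g : E -> C).

(** Differentiability is over the reals: maps from the real space [E] to C are handled through their
    real and imaginary parts. *)
Definition Cdifferentiable f x :=
  differentiable (fun y => complex.Re (f y) : R^o) x /\
  differentiable (fun y => complex.Im (f y) : R^o) x.

Definition Cderive v f x : C :=
  Complex ('D_v (fun y => complex.Re (f y) : R^o) x)
          ('D_v (fun y => complex.Im (f y) : R^o) x).

Definition CCk k U f :=
  Ck_on_open k U (fun y => complex.Re (f y) : R^o) /\
  Ck_on_open k U (fun y => complex.Im (f y) : R^o).

Lemma ReD (a b : C) : complex.Re (a + b) = complex.Re a + complex.Re b.
Proof. by case: a b => [? ?] [? ?]. Qed.

Lemma ImD (a b : C) : complex.Im (a + b) = complex.Im a + complex.Im b.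
Proof. by case: a b => [? ?] [? ?]. Qed.

Lemma ReM (a b : C) : complex.Re (a * b) =
  complex.Re a * complex.Re b - complex.Im a * complex.Im b.
Proof. by case: a b => [? ?] [? ?]. Qed.

Lemma ImM (a b : C) : complex.Im (a * b) =
  complex.Re a * complex.Im b + complex.Im a * complex.Re b.
Proof. by case: a b => [? ?] [? ?]. Qed.

Lemma CCk_differentiable k U f x : CCk k.+1 U f -> U x -> Cdifferentiable f x.
Proof. by move=> [[h1 _] [h2 _]] Ux; split; [exact: h1|exact: h2]. Qed.

Lemma CCk_eq U f g k : open U -> (forall x, U x -> f x = g x) ->
  CCk k U f -> CCk k U g.
Proof.
by move=> oU fg [hr hi]; split; [apply: Ck_on_open_eq hr|apply: Ck_on_open_eq hi];
  move=> // x Ux; rewrite fg.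
Qed.

Lemma Cderive_near_eq f g v x : (\near x, f x = g x) ->
  Cderive v f x = Cderive v g x.
Proof.
by move=> fg; congr Complex; apply: near_eq_derive; apply: filterS fg => y ->.
Qed.

Lemma CCk_cst U (a : C) k : CCk k U (cst a).
Proof. by split; exact: Ck_on_open_cst. Qed.

Lemma Cdifferentiable_cst (a : C) x : Cdifferentiable (cst a) x.
Proof. by split; exact: differentiable_cst. Qed.

Lemma Cderive_cst (a : C) v x : Cderive v (cst a) x = 0.
Proof. by rewrite /Cderive /=; congr Complex; exact: derive_cst. Qed.

Lemma CCkD U f g k : open U -> CCk k U f -> CCk k U g ->
  CCk k U (fun x => f x + g x).
Proof.
move=> oU [fr fi] [gr gi]; split.
  by apply: (Ck_on_open_eq _ _ (Ck_on_openD _ fr gr)) => // x _ /=; rewrite ReD.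
by apply: (Ck_on_open_eq _ _ (Ck_on_openD _ fi gi)) => // x _ /=; rewrite ImD.
Qed.

Lemma CdifferentiableD f g x : Cdifferentiable f x -> Cdifferentiable g x ->
  Cdifferentiable (fun x => f x + g x) x.
Proof.
move=> [fr fi] [gr gi]; split.
  by rewrite (_ : (fun y => _) = (fun y => complex.Re (f y) : R^o) +
    (fun y => complex.Re (g y) : R^o));
    [exact: differentiableD|apply/funext => y; rewrite ReD].
by rewrite (_ : (fun y => _) = (fun y => complex.Im (f y) : R^o) +
    (fun y => complex.Im (g y) : R^o));
    [exact: differentiableD|apply/funext => y; rewrite ImD].
Qed.

Lemma CderiveD f g v x : Cdifferentiable f x -> Cdifferentiable g x ->
  Cderive v (fun x => f x + g x) x = Cderive v f x + Cderive v g x.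
Proof.
move=> [fr fi] [gr gi]; rewrite /Cderive; congr Complex.
  rewrite -deriveD; [|exact: diff_derivable..].
  by congr ('D_v _ x); apply/funext => y; rewrite ReD.
rewrite -deriveD; [|exact: diff_derivable..].
by congr ('D_v _ x); apply/funext => y; rewrite ImD.
Qed.

Lemma CCkM U f g k : open U -> CCk k U f -> CCk k U g ->
  CCk k U (fun x => f x * g x).
Proof.
move=> oU [fr fi] [gr gi]; split.
  have fgi := Ck_on_openM oU (Ck_on_open_cst U (-1 : R^o) k)
    (Ck_on_openM oU fi gi).
  apply: (Ck_on_open_eq _ _ (Ck_on_openD _ (Ck_on_openM oU fr gr) fgi)) => //.
  by move=> x _ /=; rewrite ReM /cst mulN1r.
apply: (Ck_on_open_eq _ _ (Ck_on_openD _ (Ck_on_openM oU fr gi)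
  (Ck_on_openM oU fi gr))) => //.
by move=> x _ /=; rewrite ImM.
Qed.

Lemma CdifferentiableM f g x : Cdifferentiable f x -> Cdifferentiable g x ->
  Cdifferentiable (fun x => f x * g x) x.
Proof.
move=> [fr fi] [gr gi]; split.
  rewrite (_ : (fun y => _) =
    (fun y => complex.Re (f y) : R^o) * (fun y => complex.Re (g y) : R^o) -
    (fun y => complex.Im (f y) : R^o) * (fun y => complex.Im (g y) : R^o)).
    by apply: differentiableB; exact: differentiableM.
  by apply/funext => y; rewrite ReM.
rewrite (_ : (fun y => _) =
    (fun y => complex.Re (f y) : R^o) * (fun y => complex.Im (g y) : R^o) +
    (fun y => complex.Im (f y) : R^o) * (fun y => complex.Re (g y) : R^o)).
  by apply: differentiableD; exact: differentiableM.
by apply/funext => y; rewrite ImM.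
Qed.

Lemma CderiveM f g v x : Cdifferentiable f x -> Cdifferentiable g x ->
  Cderive v (fun x => f x * g x) x = Cderive v f x * g x + f x * Cderive v g x.
Proof.
move=> [/diff_derivable fr /diff_derivable fi].
move=> [/diff_derivable gr /diff_derivable gi].
have frr := fr v; have fii := fi v; have grr := gr v; have gii := gi v.
rewrite /Cderive; apply/eqP; rewrite eq_complex; apply/andP; split; apply/eqP => /=.
  rewrite (_ : (fun y => _) =
    (fun y => complex.Re (f y) : R^o) * (fun y => complex.Re (g y) : R^o) -
    (fun y => complex.Im (f y) : R^o) * (fun y => complex.Im (g y) : R^o));
    last by apply/funext => y; rewrite ReM.
  rewrite (deriveB (derivableM frr grr) (derivableM fii gii)).
  rewrite (deriveM frr grr) (deriveM fii gii).
  case: (f x) (g x) => [a b] [c d] /=; rewrite /GRing.scale /=.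
  move: ('D_v _ x) ('D_v _ x) ('D_v _ x) ('D_v _ x) => p q r s.
  by ring.
rewrite (_ : (fun y => _) =
    (fun y => complex.Re (f y) : R^o) * (fun y => complex.Im (g y) : R^o) +
    (fun y => complex.Im (f y) : R^o) * (fun y => complex.Re (g y) : R^o));
    last by apply/funext => y; rewrite ImM.
rewrite (deriveD (derivableM frr gii) (derivableM fii grr)).
rewrite (deriveM frr gii) (deriveM fii grr).
case: (f x) (g x) => [a b] [c d] /=; rewrite /GRing.scale /=.
move: ('D_v _ x) ('D_v _ x) ('D_v _ x) ('D_v _ x) => p q r s.
by ring.
Qed.

Lemma CCkV U f k : open U -> (forall x, U x -> f x != 0) ->
  CCk k U f -> CCk k U (fun x => (f x)^-1).
Proof.
move=> oU f0 [fr fi].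
have hN := Ck_on_openD oU (Ck_on_openM oU fr fr) (Ck_on_openM oU fi fi).
(* The inverse of a + ib is (a - ib) / (a^2 + b^2), whose real denominator vanishes only with a +
   ib. *)
have hV : Ck_on_open k U (fun x => (complex.Re (f x) * complex.Re (f x) +
    complex.Im (f x) * complex.Im (f x))^-1 : R^o).
  apply: Ck_on_openV hN => // x Ux; rewrite /= -!expr2.
  apply: contra (f0 _ Ux); rewrite paddr_eq0 ?sqr_ge0// !sqrf_eq0.
  by rewrite eq_complex.
split.
  apply: (Ck_on_open_eq _ _ (Ck_on_openM oU fr hV)) => // x _.
  by case: (f x) => a b /=; rewrite !expr2.
apply: (Ck_on_open_eq _ _ (Ck_on_openM oU (Ck_on_openM oU
  (Ck_on_open_cst U (-1 : R^o) k) fi) hV)) => // x _.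
by case: (f x) => a b /=; rewrite !expr2 /cst mulN1r mulNr.
Qed.

Section BigOps.
Variables (I : Type) (r : seq I) (P : pred I) (F : I -> E -> C).

Lemma CCk_sum U k : open U -> (forall i, CCk k U (F i)) ->
  CCk k U (fun x => \sum_(i <- r | P i) F i x).
Proof.
move=> oU hF; elim: r => [|i s IH].
  by apply: CCk_eq (CCk_cst U 0 k) => // x _; rewrite big_nil.
case: (boolP (P i)) => Pi.
  by apply: CCk_eq (CCkD oU (hF i) IH) => // x _; rewrite big_cons Pi.
by apply: CCk_eq IH => // x _; rewrite big_cons (negbTE Pi).
Qed.

Lemma CCk_prod U k : open U -> (forall i, CCk k U (F i)) ->
  CCk k U (fun x => \prod_(i <- r | P i) F i x).
Proof.
move=> oU hF; elim: r => [|i s IH].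
  by apply: CCk_eq (CCk_cst U 1 k) => // x _; rewrite big_nil.
case: (boolP (P i)) => Pi.
  by apply: CCk_eq (CCkM oU (hF i) IH) => // x _; rewrite big_cons Pi.
by apply: CCk_eq IH => // x _; rewrite big_cons (negbTE Pi).
Qed.

Variable x : E.
Hypothesis dF : forall i, Cdifferentiable (F i) x.

Lemma Cdifferentiable_sum : Cdifferentiable (fun x => \sum_(i <- r | P i) F i x) x.
Proof.
elim: r => [|i s IH].
  by under eq_fun do rewrite big_nil; exact: Cdifferentiable_cst.
under eq_fun do rewrite big_cons.
by case: (P i) => //; exact: CdifferentiableD.
Qed.

Lemma Cdifferentiable_prod : Cdifferentiable (fun x => \prod_(i <- r | P i) F i x) x.
Proof.
elim: r => [|i s IH].
  by under eq_fun do rewrite big_nil; exact: Cdifferentiable_cst.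
under eq_fun do rewrite big_cons.
by case: (P i) => //; exact: CdifferentiableM.
Qed.

End BigOps.

Lemma Cderive_sum (I : Type) (r : seq I) (P : pred I) (F : I -> E -> C) v x :
  (forall i, Cdifferentiable (F i) x) ->
  Cderive v (fun x => \sum_(i <- r | P i) F i x) x =
  \sum_(i <- r | P i) Cderive v (F i) x.
Proof.
move=> dF; elim: r => [|i s IH].
  by under eq_fun do rewrite big_nil; rewrite big_nil; exact: Cderive_cst.
under eq_fun do rewrite big_cons; rewrite big_cons.
case: (P i) => //; rewrite CderiveD ?IH//; exact: Cdifferentiable_sum.
Qed.

Lemma Cderive_prod1 (I : Type) (r : seq I) (F : I -> E -> C) v x :
  (forall i, Cdifferentiable (F i) x) -> (forall i, F i x = 1) ->
  Cderive v (fun x => \prod_(i <- r) F i x) x = \sum_(i <- r) Cderive v (F i) x.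
Proof.
move=> dF F1; elim: r => [|i s IH].
  by under eq_fun do rewrite big_nil; rewrite big_nil; exact: Cderive_cst.
under eq_fun do rewrite big_cons; rewrite big_cons.
rewrite CderiveM//; last exact: Cdifferentiable_prod.
by rewrite IH F1 mul1r big1// mulr1.
Qed.

(** Each term of the Leibniz expansion differentiates a single factor, so it keeps [F i] or [F j],
    and both vanish at [x]. *)
Lemma Cderive_prod0 (I : finType) (F : I -> E -> C) v x i j :
  (forall i, Cdifferentiable (F i) x) -> i != j -> F i x = 0 -> F j x = 0 ->
  Cderive v (fun x => \prod_i F i x) x = 0.
Proof.
move=> dF ij Fi Fj.
under eq_fun do rewrite (bigD1 i)//= (bigD1 j) 1?eq_sym//=.
have dP := Cdifferentiable_prod (index_enum I)
  (fun l : I => (l != i) && (l != j)) dF.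
rewrite CderiveM//; last exact: CdifferentiableM.
by rewrite Fi Fj !mul0r mulr0 addr0.
Qed.

End ComplexCalculus.

(** * Complex matrix-valued functions *)

Section ComplexMatrixCalculus.
Context {R : realType} {E : normedModType R}.
Local Notation C := R[i].
Implicit Types (U : set E) (k : nat).

Definition Mdifferentiable m n (A : E -> 'M[C]_(m, n)) x :=
  forall i j, Cdifferentiable (fun y => A y i j) x.

Definition Mderive m n v (A : E -> 'M[C]_(m, n)) x : 'M[C]_(m, n) :=
  \matrix_(i, j) Cderive v (fun y => A y i j) x.

Definition MCk m n k U (A : E -> 'M[C]_(m, n)) :=
  forall i j, CCk k U (fun y => A y i j).

Lemma MCk_differentiable m n k U (A : E -> 'M[C]_(m, n)) x :
  MCk k.+1 U A -> U x -> Mdifferentiable A x.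
Proof. by move=> hA Ux i j; exact: CCk_differentiable (hA i j) Ux. Qed.

Lemma MCk_eq m n k U (A B : E -> 'M[C]_(m, n)) : open U ->
  (forall x, U x -> A x = B x) -> MCk k U A -> MCk k U B.
Proof. by move=> oU AB hA i j; apply: CCk_eq (hA i j) => // x Ux; rewrite AB. Qed.

Lemma MCk_cst m n U (A : 'M[C]_(m, n)) k : MCk k U (cst A).
Proof. by move=> i j; exact: CCk_cst. Qed.

Lemma Mdifferentiable_cst m n (A : 'M[C]_(m, n)) x : Mdifferentiable (cst A) x.
Proof. by move=> i j; exact: Cdifferentiable_cst. Qed.

Lemma Mderive_cst m n (A : 'M[C]_(m, n)) v x : Mderive v (cst A) x = 0.
Proof. by apply/matrixP => i j; rewrite !mxE; exact: Cderive_cst. Qed.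

Lemma MCkM m n p U (A : E -> 'M[C]_(m, n)) (B : E -> 'M[C]_(n, p)) k : open U ->
  MCk k U A -> MCk k U B -> MCk k U (fun x => A x *m B x).
Proof.
move=> oU hA hB i j; under eq_fun do rewrite mxE.
by apply: CCk_sum => // l; apply: CCkM; [|exact: hA|exact: hB].
Qed.

Lemma MdifferentiableM m n p (A : E -> 'M[C]_(m, n)) (B : E -> 'M[C]_(n, p)) x :
  Mdifferentiable A x -> Mdifferentiable B x ->
  Mdifferentiable (fun x => A x *m B x) x.
Proof.
move=> hA hB i j; under eq_fun do rewrite mxE.
by apply: Cdifferentiable_sum => l; apply: CdifferentiableM; [exact: hA|exact: hB].
Qed.

Lemma MderiveM m n p (A : E -> 'M[C]_(m, n)) (B : E -> 'M[C]_(n, p)) v x :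
  Mdifferentiable A x -> Mdifferentiable B x ->
  Mderive v (fun x => A x *m B x) x = Mderive v A x *m B x + A x *m Mderive v B x.
Proof.
move=> hA hB; apply/matrixP => i j; rewrite !mxE.
under eq_fun do rewrite mxE.
rewrite Cderive_sum; last first.
  by move=> l; apply: CdifferentiableM; [exact: hA|exact: hB].
rewrite -big_split /=; apply: eq_bigr => l _; rewrite !mxE.
by apply: CderiveM; [exact: hA|exact: hB].
Qed.

Section LinearMap.
Variables (m n p q : nat) (j : {linear 'M[C]_(m, n) -> 'M[C]_(p, q)}).

(** Expansion in matrix units: the entries of [j A] are combinations of those of [A] with constant
    coefficients, so the rules for sums and products give the regularity and the derivative of
    [j (A x)]. *)
Lemma linear_mxE (A : 'M[C]_(m, n)) a b :
  j A a b = \sum_i \sum_l A i l * j (delta_mx i l) a b.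
Proof.
rewrite {1}[A]matrix_sum_delta linear_sum summxE; apply: eq_bigr => i _.
rewrite linear_sum summxE; apply: eq_bigr => l _.
by rewrite linearZ mxE.
Qed.

Lemma MCk_linear U (A : E -> 'M[C]_(m, n)) k : open U ->
  MCk k U A -> MCk k U (fun x => j (A x)).
Proof.
move=> oU hA a b; under eq_fun do rewrite linear_mxE.
apply: CCk_sum => // i; apply: CCk_sum => // l.
by apply: CCkM => //; exact: CCk_cst.
Qed.

Lemma Mderive_linear (A : E -> 'M[C]_(m, n)) v x :
  Mdifferentiable A x -> Mderive v (fun x => j (A x)) x = j (Mderive v A x).
Proof.
move=> hA; apply/matrixP => a b; rewrite linear_mxE mxE.
under eq_fun do rewrite linear_mxE.
have dt i l : Cdifferentiable (fun y => A y i l * j (delta_mx i l) a b) x.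
  by apply: CdifferentiableM => //; exact: Cdifferentiable_cst.
rewrite Cderive_sum; last by move=> i; exact: Cdifferentiable_sum.
apply: eq_bigr => i _; rewrite Cderive_sum//; apply: eq_bigr => l _.
rewrite (CderiveM _ (hA i l) (Cdifferentiable_cst _ _)) mxE.
by rewrite Cderive_cst mulr0 addr0.
Qed.

End LinearMap.

Lemma CCk_det n U (A : E -> 'M[C]_n) k : open U ->
  MCk k U A -> CCk k U (fun x => \det (A x)).
Proof.
move=> oU hA; apply: CCk_sum => // s; apply: CCkM => //; first exact: CCk_cst.
exact: CCk_prod.
Qed.

Lemma MCk_adj n U (A : E -> 'M[C]_n) k : open U ->
  MCk k U A -> MCk k U (fun x => \adj (A x)).
Proof.
move=> oU hA i j; under eq_fun do rewrite mxE.
apply: CCkM => //; first exact: CCk_cst.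
(* A cofactor is, up to sign, the determinant of a submatrix. *)
by apply: CCk_det => // a b; under eq_fun do rewrite !mxE.
Qed.

(* At the identity only the identity permutation contributes: any other one
   moves two indices, giving two vanishing factors. *)
Lemma Cderive_det1 n (A : E -> 'M[C]_n) v x : Mdifferentiable A x ->
  A x = 1%:M -> Cderive v (fun x => \det (A x)) x = \tr (Mderive v A x).
Proof.
move=> hA A1; rewrite /determinant.
have dp (s : 'S_n) : Cdifferentiable (fun y => \prod_i A y i (s i)) x.
  exact: Cdifferentiable_prod.
rewrite Cderive_sum; last first.
  by move=> s; apply: CdifferentiableM => //; exact: Cdifferentiable_cst.
rewrite (bigD1 (1%g : 'S_n)) //= big1 ?addr0.
  rewrite (CderiveM _ (Cdifferentiable_cst _ _) (dp _)) Cderive_cst mul0r add0r.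
  rewrite /cst odd_perm1 mul1r Cderive_prod1//.
    by apply: eq_bigr => i _; rewrite mxE perm1.
  by move=> i; rewrite A1 perm1 mxE eqxx.
move=> s s1; rewrite (CderiveM _ (Cdifferentiable_cst _ _) (dp _)).
rewrite Cderive_cst mul0r add0r.
have [i si] : exists i, s i != i.
  apply/existsP; rewrite -negb_forall; apply: contra s1 => /forallP h.
  by apply/eqP/permP => i; rewrite perm1; exact/eqP.
rewrite (@Cderive_prod0 _ _ _ _ v x i (s i)) ?mulr0//.
- by rewrite eq_sym.
- by rewrite A1 mxE eq_sym (negbTE si).
- by rewrite A1 mxE (inj_eq perm_inj) eq_sym (negbTE si).
Qed.

End ComplexMatrixCalculus.

(** * Complex matrices as pairs of real matrices *)

Section ComplexPairs.
Context {R : realType} {n : nat}.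
Local Notation C := R[i].
Local Notation V := ('M[R]_n * 'M[R]_n)%type.

Lemma to_complexK : cancel (@to_complex R n) (@of_complex R n).
Proof. by move=> [a b]; congr pair; apply/matrixP => i j; rewrite !mxE. Qed.

Lemma of_complexK : cancel (@of_complex R n) (@to_complex R n).
Proof. by move=> A; apply/matrixP => i j; rewrite !mxE /=; case: (A i j). Qed.

Lemma to_complexD (x y : V) : to_complex (x + y) = to_complex x + to_complex y.
Proof. by apply/matrixP => i j; rewrite !mxE. Qed.

Lemma to_complexN (x : V) : to_complex (- x) = - to_complex x.
Proof. by apply/matrixP => i j; rewrite !mxE. Qed.

Lemma to_complexB (x y : V) : to_complex (x - y) = to_complex x - to_complex y.
Proof. by rewrite to_complexD to_complexN. Qed.

Lemma to_complexZ (a : R) (x : V) :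
  to_complex (a *: x) = Complex a 0 *: to_complex x.
Proof.
apply/matrixP => i j; rewrite !mxE.
by apply/eqP; rewrite eq_complex /= !mul0r subr0 addr0 !eqxx.
Qed.

Lemma linear_Re_coord i j : linear (fun x : V => x.1 i j : R^o).
Proof. by move=> a x y; rewrite !mxE. Qed.

Lemma linear_Im_coord i j : linear (fun x : V => x.2 i j : R^o).
Proof. by move=> a x y; rewrite !mxE. Qed.

Lemma continuous_Re_coord i j : continuous (fun x : V => x.1 i j : R^o).
Proof.
move=> x; apply: (@continuous_comp _ _ _ fst (fun M : 'M[R]_n => M i j : R^o)).
  exact: cvg_fst.
exact: coord_continuous.
Qed.

Lemma continuous_Im_coord i j : continuous (fun x : V => x.2 i j : R^o).
Proof.
move=> x; apply: (@continuous_comp _ _ _ snd (fun M : 'M[R]_n => M i j : R^o)).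
  exact: cvg_snd.
exact: coord_continuous.
Qed.

Context {E : normedModType R}.
Implicit Types (U : set E) (f : E -> V).

(** The real and imaginary parts of each entry are continuous linear forms on [V], and these commute
    with derivation. *)
Lemma differentiable_to_complex f x v : differentiable f x ->
  Mdifferentiable (@to_complex R n \o f) x /\
  to_complex ('D_v f x) = Mderive v (@to_complex R n \o f) x.
Proof.
move=> df.
have hr w i j :=
  derive_comp_linear w (linear_Re_coord i j) (@continuous_Re_coord i j) df.
have hi w i j :=
  derive_comp_linear w (linear_Im_coord i j) (@continuous_Im_coord i j) df.
have er i j : (fun y => complex.Re ((@to_complex R n \o f) y i j)) =
    (fun x : V => x.1 i j : R^o) \o f by apply/funext => y; rewrite /= mxE.
have ei i j : (fun y => complex.Im ((@to_complex R n \o f) y i j)) =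
    (fun x : V => x.2 i j : R^o) \o f by apply/funext => y; rewrite /= mxE.
split=> [i j|].
  by split; [rewrite er; case: (hr v i j)|rewrite ei; case: (hi v i j)].
apply/matrixP => i j; rewrite !mxE; congr Complex.
  by rewrite er; case: (hr v i j) => _ ->.
by rewrite ei; case: (hi v i j) => _ ->.
Qed.

Lemma Ck_to_complex U f k : open U ->
  Ck_on_open k U f -> MCk k U (@to_complex R n \o f).
Proof.
move=> oU hf i j; split.
  apply: (Ck_on_open_eq oU _ (Ck_on_open_linear oU (linear_Re_coord i j)
    (@continuous_Re_coord i j) hf)).
  by move=> x _; rewrite /= mxE.
apply: (Ck_on_open_eq oU _ (Ck_on_open_linear oU (linear_Im_coord i j)
    (@continuous_Im_coord i j) hf)).
by move=> x _; rewrite /= mxE.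
Qed.

Lemma Ck_of_complex U (A : E -> 'M[C]_n) k : open U ->
  MCk k U A -> Ck_on_open k U (@of_complex R n \o A).
Proof.
move=> oU hA.
have hZ (W : normedModType R) (w : W) (g : E -> R^o) :
    Ck_on_open k U g -> Ck_on_open k U (fun x => g x *: w).
  move=> hg.
  have lw : linear (fun r : R^o => r *: w : W).
    by move=> a r s; rewrite scalerDl scalerA.
  apply: (Ck_on_open_linear oU lw _ hg); exact: scalel_continuous.
(* A real matrix is the sum of its entries times constant matrix units, so entrywise regularity
   suffices. *)
have hM (a : E -> 'M[R]_n) :
    (forall i j, Ck_on_open k U (fun x => a x i j : R^o)) -> Ck_on_open k U a.
  move=> ha.
  have hs : Ck_on_open k U
      (fun x => \sum_i \sum_j a x i j *: delta_mx i j : 'M[R]_n).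
    apply: Ck_on_open_sum => // i _; apply: Ck_on_open_sum => // j _.
    exact: hZ.
  by apply: (Ck_on_open_eq oU _ hs) => x _; rewrite -matrix_sum_delta.
apply: (@Ck_on_open_pair R E _ _ U (fun x => map_mx (@complex.Re R) (A x))
   (fun x => map_mx (@complex.Im R) (A x))) => //.
  by apply: hM => i j; apply: (Ck_on_open_eq oU _ (hA i j).1) => x _; rewrite mxE.
by apply: hM => i j; apply: (Ck_on_open_eq oU _ (hA i j).2) => x _; rewrite mxE.
Qed.

Lemma derive_of_complex U (A : E -> 'M[C]_n) v x : open U -> U x ->
  MCk 1 U A -> 'D_v (@of_complex R n \o A) x = of_complex (Mderive v A x).
Proof.
move=> oU Ux hA; have [df _] := Ck_of_complex oU hA.
have [_ h] := differentiable_to_complex v (df _ Ux).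
apply: (can_inj to_complexK); rewrite h of_complexK.
by congr Mderive; apply/funext => y /=; rewrite of_complexK.
Qed.

End ComplexPairs.

(** * Block triangular decomposition *)

Lemma mxtraceN (F : pzRingType) n (A : 'M[F]_n) : \tr (- A) = - \tr A.
Proof. exact: raddfN. Qed.

Lemma mxtraceB (F : pzRingType) n (A B : 'M[F]_n) : \tr (A - B) = \tr A - \tr B.
Proof. exact: raddfB. Qed.

Section BlockTriangular.
Context {F : comNzRingType} {n : nat}.
Variable (lev : 'I_n.+1 -> nat).
Local Notation M := 'M[F]_n.+1.
Implicit Types (A B X : M).

(** The projection T of the overview, with [lev] numbering the blocks. Diagonal blocks are kept, so
    [A - upper_part A] is strictly block lower triangular. *)
Definition upper_part A : M :=
  \matrix_(i, j) if (lev i <= lev j)%N then A i j else 0.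

Fact upper_part_is_linear : linear upper_part.
Proof.
by move=> a A B; apply/matrixP => i j; rewrite !mxE; case: ifP => // _;
  rewrite mulr0 addr0.
Qed.

HB.instance Definition _ := GRing.isLinear.Build F M M _ upper_part
  upper_part_is_linear.

Lemma upper_part_id A : upper_part (upper_part A) = upper_part A.
Proof. by apply/matrixP => i j; rewrite !mxE; case: leqP. Qed.

Lemma upper_part_low A : upper_part (A - upper_part A) = 0.
Proof. by rewrite linearB /= upper_part_id subrr. Qed.

(** At a position with lev j < lev i, the chain lev i <= lev k <= lev j is impossible, so each
    product [A i k * B k j] has a vanishing factor. *)
Lemma upper_mul A B : upper_part A = A -> upper_part B = B ->
  upper_part (A * B) = A * B.
Proof.
move=> /matrixP hA /matrixP hB; apply/matrixP => i j; rewrite !mxE.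
case: ifP => // /negbT; rewrite -ltnNge => ji.
apply/esym/big1 => k _; have := hA i k; have := hB k j; rewrite !mxE.
case: leqP => [kj _|_ <-]; last by rewrite mulr0.
case: leqP => [ik _|_ <-]; last by rewrite mul0r.
by have := leq_trans ik kj; rewrite leqNgt ji.
Qed.

Lemma lower_mul A B : upper_part A = 0 -> upper_part B = 0 ->
  upper_part (A * B) = 0.
Proof.
move=> /matrixP hA /matrixP hB; apply/matrixP => i j; rewrite !mxE.
case: ifP => // ij.
apply/big1 => k _; have := hA i k; have := hB k j; rewrite !mxE.
case: leqP => [kj ->|jk _]; first by rewrite mulr0.
case: leqP => [ik ->|ki _]; first by rewrite mul0r.
by have := ltn_trans jk ki; rewrite ltnNge ij.
Qed.

Definition block_diagonal (Q : M) := forall i j, lev i != lev j -> Q i j = 0.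

Variable Q : M.
Hypothesis blockQ : block_diagonal Q.

Lemma upper_part_mull A : upper_part (Q * A) = Q * upper_part A.
Proof.
apply/matrixP => i j; rewrite !mxE -[RHS]/(\sum_k _).
(* Truncation is additive, so it moves inside the sum over [k]; there only indices of the same level
   as [i] contribute, for which both truncations agree. *)
rewrite (big_morph (fun x => if (lev i <= lev j)%N then x else 0)
  (id1 := 0) (op1 := +%R)); last 2 first.
- by move=> x y; case: ifP; rewrite ?addr0.
- by case: ifP.
apply: eq_bigr => k _; rewrite !mxE.
have [<-|ik] := eqVneq (lev i) (lev k); first by case: ifP; rewrite ?mulr0.
by rewrite blockQ// !mul0r; case: ifP.
Qed.

Lemma upper_part_mulr A : upper_part (A * Q) = upper_part A * Q.
Proof.
apply/matrixP => i j; rewrite !mxE -[RHS]/(\sum_k _).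
rewrite (big_morph (fun x => if (lev i <= lev j)%N then x else 0)
  (id1 := 0) (op1 := +%R)); last 2 first.
- by move=> x y; case: ifP; rewrite ?addr0.
- by case: ifP.
apply: eq_bigr => k _; rewrite !mxE.
have [->|kj] := eqVneq (lev k) (lev j); first by case: ifP; rewrite ?mul0r.
by rewrite blockQ// !mulr0; case: ifP.
Qed.

(** The diagonal entries of [Q * A] involve only the diagonal blocks of [A], which vanish. *)
Lemma mxtrace_block_lower A : upper_part A = 0 -> \tr (Q * A) = 0.
Proof.
move=> /matrixP hA; rewrite /mxtrace big1// => i _.
rewrite !mxE big1// => k _.
have [ik|ik] := eqVneq (lev i) (lev k); last by rewrite blockQ// mul0r.
by have := hA k i; rewrite !mxE ik leqnn => ->; rewrite mulr0.
Qed.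

Hypothesis lev_max : forall i, i != ord_max -> (lev i < lev ord_max)%N.

Definition corner : M := delta_mx ord_max ord_max.

(** Multiplication by [corner] on the right keeps only the last column; since the last index has the
    highest level, no entry of that column is strictly block lower. *)
Lemma corner_lower A : upper_part A = 0 -> A * corner = 0.
Proof.
move=> /matrixP hA; apply/matrixP => i j; rewrite !mxE big1// => k _.
rewrite !mxE; have [->|_] := eqVneq k ord_max; last by rewrite mulr0.
have := hA i ord_max; rewrite !mxE.
have [->|/lev_max/ltnW ->] := eqVneq i ord_max; last by move=> ->; rewrite mul0r.
by rewrite leqnn => ->; rewrite mul0r.
Qed.

(** Multiplication by [corner] on the left keeps only the last row, where a block upper triangular
    matrix has at most its last entry. *)
Lemma corner_upper A : upper_part A = A ->
  corner * A = A ord_max ord_max *: corner.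
Proof.
move=> /matrixP hA; apply/matrixP => i j; rewrite !mxE (bigD1 ord_max)//= big1.
  rewrite !mxE eqxx andbT addr0.
  have [_|_] := eqVneq i ord_max; last by rewrite mul0r mulr0.
  rewrite mul1r /=; have [->|jm] := eqVneq j ord_max; first by rewrite mulr1.
  rewrite mulr0; have := hA ord_max j; rewrite !mxE leqNgt (lev_max jm) /=.
  by move=> <-.
by move=> k km; rewrite !mxE (negbTE km) andbF mul0r.
Qed.

Lemma upper_part_corner : upper_part corner = corner.
Proof.
apply/matrixP => i j; rewrite !mxE; case: ifP => //.
by case: eqP => [->|//]; case: eqP => [->|//]; rewrite leqnn.
Qed.

Lemma mxtrace_corner : \tr corner = 1.
Proof.
rewrite /mxtrace (bigD1 ord_max)//= big1 ?addr0 ?mxE ?eqxx//.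
by move=> i im; rewrite mxE (negbTE im).
Qed.

Definition block_structure A : M :=
  Q * upper_part A - (A - upper_part A) * Q - \tr (Q * A) *: corner.

Fact block_structure_is_linear : linear block_structure.
Proof.
move=> a A B; rewrite /block_structure.
have -> : \tr (Q * (a *: A + B)) = a * \tr (Q * A) + \tr (Q * B).
  by rewrite mulrDr -scalerAr mxtraceD mxtraceZ.
rewrite linearP /= mulrDr -scalerAr.
apply/matrixP => i j.
rewrite !mulrBl !mulrDl -!scalerAl.
move: (Q * upper_part A) (Q * upper_part B) (A * Q) (B * Q) (upper_part A * Q)
  (upper_part B * Q) => p q r s t u.
by rewrite !mxE; ring.
Qed.

HB.instance Definition _ := GRing.isLinear.Build F M M _ block_structure
  block_structure_is_linear.

Local Notation J := block_structure.

(** Together with the next lemma: [J] respects the splitting into block upper and strictly lower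
    parts, acting on the former by left multiplication by [Q] with a correction along [corner], on
    the latter by right multiplication by [- Q]. *)
Lemma upper_block_structure A :
  upper_part (J A) = Q * upper_part A - \tr (Q * A) *: corner.
Proof.
rewrite /block_structure !linearB /= upper_part_mull upper_part_id.
rewrite linearZ /= upper_part_corner upper_part_mulr linearB /=.
by rewrite upper_part_id subrr mul0r subr0.
Qed.

Lemma lower_block_structure A :
  J A - upper_part (J A) = - ((A - upper_part A) * Q).
Proof.
rewrite upper_block_structure /block_structure.
by rewrite opprB addrA subrK addrC addrA addNr add0r.
Qed.

Lemma mxtrace_block_upper A : \tr (Q * upper_part A) = \tr (Q * A).
Proof.
apply/eqP; rewrite -subr_eq0 -mxtraceB.
by rewrite -mulrBr -opprB mulrN mxtraceN mxtrace_block_lower ?oppr0// upper_part_low.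
Qed.

(** The multiple of [corner] is chosen to cancel the trace of the upper term; the strictly lower
    term is traceless. *)
Lemma mxtrace_block_structure A : \tr (J A) = 0.
Proof.
rewrite /block_structure !mxtraceB mxtraceZ mxtrace_corner mulr1.
rewrite mxtrace_block_upper addrAC subrr add0r.
by rewrite -mulmxE mxtrace_mulC mulmxE mxtrace_block_lower ?oppr0// upper_part_low.
Qed.

End BlockTriangular.

(** * Squares, anticommutation and Nijenhuis tensors of the operators j_Q *)

Section BlockStructures.
Context {F : comNzRingType} {n : nat} (lev : 'I_n.+1 -> nat).
Local Notation M := 'M[F]_n.+1.
Local Notation upper := (upper_part lev).
Local Notation J := (block_structure lev).
Local Notation e := (corner : M).
Implicit Types (A B X Y Q : M).
Hypothesis lev_max : forall i, i != ord_max -> (lev i < lev ord_max)%N.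

(** Left multiplications compose as Q1 Q2, right ones in the opposite order Q2 Q1 with the two signs
    cancelling, and Q1 e = 0 removes the inner corner term. *)
Lemma block_structure_comp Q1 Q2 A :
  block_diagonal lev Q1 -> block_diagonal lev Q2 -> Q1 * e = 0 ->
  J Q1 (J Q2 A) = Q1 * Q2 * upper A + (A - upper A) * (Q2 * Q1)
                  - \tr (Q1 * Q2 * A) *: e.
Proof.
move=> b1 b2 Q1e.
have tr12 : \tr (Q1 * J Q2 A) = \tr (Q1 * Q2 * A).
  rewrite -(mxtrace_block_upper b1) upper_block_structure//.
  rewrite mulrBr mxtraceB -scalerAr Q1e scaler0 mxtrace0 subr0.
  by rewrite -upper_part_mull// mxtrace_block_upper// mulrA.
rewrite {1}/block_structure lower_block_structure// upper_block_structure// tr12.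
by rewrite mulrBr -scalerAr Q1e scaler0 subr0 mulNr opprK !mulrA.
Qed.

Lemma block_structure_anticomm Q1 Q2 A :
  block_diagonal lev Q1 -> block_diagonal lev Q2 -> Q1 * e = 0 -> Q2 * e = 0 ->
  Q1 * Q2 = - (Q2 * Q1) -> J Q1 (J Q2 A) = - J Q2 (J Q1 A).
Proof.
move=> b1 b2 Q1e Q2e Q12; rewrite !block_structure_comp// Q12.
rewrite !mulNr mxtraceN scaleNr mulrN.
move: (Q2 * Q1 * upper A) (_ * _) (_ *: e) => p q r.
by rewrite !opprD !opprK.
Qed.

Variable Q : M.
Hypotheses (blockQ : block_diagonal lev Q) (Qe : Q * e = 0) (eQ : e * Q = 0).
Hypothesis QQ : Q * Q = e - 1.

(** With Q^2 = e - 1, the lower part is negated because its last column is zero. On the upper part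
    the surplus e T(A) = A_nn e cancels against the trace term - tr((e - 1) A) e, leaving tr(A)
    e. *)
Lemma block_structure_sqr A : J Q (J Q A) = - A + \tr A *: e.
Proof.
have lowe : (A - upper A) * e = 0 by rewrite (corner_lower lev_max) ?upper_part_low.
rewrite block_structure_comp// QQ mulrBr lowe mulr1 !mulrBl !mul1r mxtraceB.
(* The matrix [corner] is itself block diagonal, so the trace against it sees only the upper
   part. *)
have tre X : \tr (e * upper X) = \tr (e * X).
  apply: mxtrace_block_upper => i j ij; rewrite mxE.
  by case: eqP => //= im; case: eqP => //= jm; rewrite im jm eqxx in ij.
rewrite -tre (corner_upper lev_max) ?upper_part_id// mxtraceZ mxtrace_corner mulr1.
rewrite scalerBl; apply/matrixP => i j; rewrite !mxE; ring.
Qed.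

Definition nijenhuis_tensor (j : M -> M) (X Y : M) : M :=
  (j X * j Y - j Y * j X) - (X * Y - Y * X)
  - j (j X * Y - Y * j X) - j (X * j Y - j Y * X).

Lemma nijenhuis_tensorC (j : {linear M -> M}) X Y :
  nijenhuis_tensor j X Y = - nijenhuis_tensor j Y X.
Proof.
rewrite /nijenhuis_tensor !linearB /=; apply/matrixP => a b.
move: (j (_ * _)) (j (_ * _)) (j (_ * _)) (j (_ * _)) => p q r s.
move: (j X * j Y) (j Y * j X) (X * Y) (Y * X) => p' q' r' s'.
by rewrite !mxE; ring.
Qed.

Lemma nijenhuis_tensorDr (j : {linear M -> M}) X Y Y' :
  nijenhuis_tensor j X (Y + Y') = nijenhuis_tensor j X Y + nijenhuis_tensor j X Y'.
Proof.
rewrite /nijenhuis_tensor [j (Y + Y')]linearD /= !mulrDr !mulrDl.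
rewrite !(linearB j, linearD j) /=.
apply/matrixP => a b.
move: (j (_ * _)) (j (_ * _)) (j (_ * _)) (j (_ * _)) => p q r s.
move: (j (_ * _)) (j (_ * _)) (j (_ * _)) (j (_ * _)) => p2 q2 r2 s2.
move: (j X * j Y) (j Y * j X) (X * Y) (Y * X) => p' q' r' s'.
move: (j X * j Y') (j Y' * j X) (X * Y') (Y' * X) => p2' q2' r2' s2'.
by rewrite !mxE; ring.
Qed.

Lemma block_structure_upper X : upper X = X ->
  J Q X = Q * X - \tr (Q * X) *: e.
Proof. by move=> uX; rewrite /block_structure uX subrr mul0r subr0. Qed.

Lemma block_structure_lower Y : upper Y = 0 -> J Q Y = - (Y * Q).
Proof.
move=> lY; rewrite /block_structure lY mulr0 subr0 sub0r.
by rewrite (mxtrace_block_lower blockQ)// scale0r subr0.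
Qed.

(** With products associated to the right, this rule and the next two normalize words in [Q], [e]
    and other matrices. *)
Lemma QQmull X : Q * (Q * X) = e * X - X.
Proof. by rewrite mulrA QQ mulrBl mul1r. Qed.

Lemma Qemull X : Q * (e * X) = 0. Proof. by rewrite mulrA Qe mul0r. Qed.

Lemma eQmull X : e * (Q * X) = 0. Proof. by rewrite mulrA eQ mul0r. Qed.

(** Block upper matrices are stable under [J Q] and commutators. For Z = [JX, Y] + [X, JY] one finds
    QZ = [JX, JY] - [X, Y], which is traceless, so JZ = QZ and the tensor vanishes. *)
Lemma nijenhuis_upper X Y : upper X = X -> upper Y = Y ->
  nijenhuis_tensor (J Q) X Y = 0.
Proof.
move=> uX uY.
have uQ Z : upper Z = Z -> upper (Q * Z) = Q * Z.
  by move=> uZ; rewrite upper_part_mull ?uZ.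
have uJ Z : upper Z = Z -> upper (J Q Z) = J Q Z.
  by move=> uZ; rewrite upper_block_structure// uZ block_structure_upper.
have uC Z W : upper Z = Z -> upper W = W ->
    upper (Z * W - W * Z) = Z * W - W * Z.
  by move=> uZ uW; rewrite linearB /= !upper_mul.
rewrite /nijenhuis_tensor -addrA -opprD -(linearD (J Q)) /=.
set Z := (J Q X * Y - Y * J Q X) + (X * J Q Y - J Q Y * X).
have uZ : upper Z = Z by rewrite linearD /= !uC// uJ.
have QZ : Q * Z = (J Q X * J Q Y - J Q Y * J Q X) - (X * Y - Y * X).
  have eX := corner_upper lev_max uX; have eY := corner_upper lev_max uY.
  (* The last diagonal entry is multiplicative on block upper matrices, hence blind to the order of
     the factors. *)
  have eXY : e * (X * Y) = e * (Y * X).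
    rewrite !mulrA eX eY -!scalerAl eX eY !scalerA.
    by rewrite [X _ _ * _]mulrC.
  rewrite /Z !block_structure_upper//.
  move: (\tr _) (\tr _) => s t.
  rewrite !(mulrBr, mulrBl, mulrDr) -?scalerAl -?scalerAr -!mulrA.
  rewrite !(QQmull, Qemull, eQmull, Qe, eQ) eXY.
  apply/matrixP => i j.
  move: (Q * (X * (Q * Y))) (Q * (Y * (Q * X))) (Q * (X * e)) (Q * (Y * e)).
  move: (e * (Y * X)) (X * Y) (Y * X) (e * e) => a b c d f g h k.
  by rewrite !mxE; ring.
rewrite (block_structure_upper uZ) QZ !mxtraceB -!mulmxE.
rewrite [\tr (J Q X *m _)]mxtrace_mulC [\tr (X *m _)]mxtrace_mulC.
by rewrite !subrr scale0r subr0 subrr.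
Qed.

(** Strictly lower matrices are stable under products and [J Q], which is right multiplication by
    [- Q] there; as they kill [e] on their right, right multiplication by Q^2 is -1 on them. *)
Lemma nijenhuis_lower X Y : upper X = 0 -> upper Y = 0 ->
  nijenhuis_tensor (J Q) X Y = 0.
Proof.
move=> lX lY.
have lQ Z : upper Z = 0 -> upper (Z * Q) = 0.
  by move=> lZ; rewrite upper_part_mulr ?lZ ?mul0r.
have lC Z W : upper Z = 0 -> upper W = 0 -> upper (Z * W - W * Z) = 0.
  by move=> lZ lW; rewrite linearB /= !lower_mul// subr0.
rewrite /nijenhuis_tensor -addrA -opprD -(linearD (J Q)) /=.
set Z := (J Q X * Y - Y * J Q X) + (X * J Q Y - J Q Y * X).
have lJ W : upper W = 0 -> upper (J Q W) = 0.
  by move=> lW; rewrite block_structure_lower// linearN /= lQ ?oppr0.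
have lZ : upper Z = 0 by rewrite linearD /= !lC ?addr0 ?lJ.
rewrite (block_structure_lower lZ) /Z !block_structure_lower//.
rewrite !(mulrBr, mulrBl, mulrDl, mulNr, mulrN) -!mulrA QQ !mulrBr !mulr1.
rewrite !(corner_lower lev_max)// !mulr0.
apply/matrixP => i j.
move: (X * (Q * (Y * Q))) (Y * (Q * (X * Q))) (X * Y) (Y * X) => a b c d.
by rewrite !mxE; ring.
Qed.

(** With Z = XY and s = tr(QX), the terms YQX cancel in [JX, Y] + [X, JY], leaving [Q, Z] - s eY.
    Its image under J is - QZQ - Z + s eYQ, and [JX, JY] - [X, Y] is the same matrix. *)
Lemma nijenhuis_upper_lower X Y : upper X = X -> upper Y = 0 ->
  nijenhuis_tensor (J Q) X Y = 0.
Proof.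
move=> uX lY.
have Ye : Y * e = 0 := corner_lower lev_max lY.
rewrite /nijenhuis_tensor -addrA -opprD -(linearD (J Q)) /=.
rewrite (block_structure_upper uX) (block_structure_lower lY).
set s := \tr _; set Z := X * Y.
have -> : (Q * X - s *: e) * Y - Y * (Q * X - s *: e) +
    (X * - (Y * Q) - - (Y * Q) * X) = (Q * Z - Z * Q) - s *: (e * Y).
  rewrite !(mulrBr, mulrBl, mulNr, mulrN) -?scalerAl -?scalerAr Ye /Z -!mulrA.
  apply/matrixP => i j.
  move: (Q * (X * Y)) (Y * (Q * X)) (X * (Y * Q)) (e * Y) => a b c d.
  by rewrite !mxE; ring.
have leY : upper (e * Y) = 0.
  apply/matrixP => i j; move/matrixP: lY => /(_ i j); rewrite !mxE.
  case: leqP => // ij; rewrite (bigD1 ord_max)//= big1 ?addr0 => [|k km]; last first.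
    by rewrite !mxE (negbTE km) andbF mul0r.
  rewrite !mxE eqxx andbT; case: eqP ij => [-> ij ->|_ _ _]; last by rewrite mul0r.
  by rewrite mulr0.
have -> : J Q (Q * Z - Z * Q - s *: (e * Y)) =
    J Q (Q * Z - Z * Q) + s *: (e * Y * Q).
  rewrite addrC -scaleNr linearP /= (block_structure_lower leY).
  by rewrite scaleNr scalerN opprK addrC.
have Ze : Z * e = 0 by rewrite -mulrA Ye mulr0.
have uZe : upper Z * e = 0.
  rewrite -[upper Z](subKr Z) mulrBl Ze sub0r (corner_lower lev_max) ?oppr0//.
  exact: upper_part_low.
(* Here e W is a multiple of e for W = [upper Z], so e W = e W e, which is zero since W e = 0. *)
have euZ : e * upper Z = 0.
  have := corner_upper lev_max (upper_part_id lev Z) => eZ.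
  have ee : e * e = e.
    by rewrite (corner_upper lev_max) ?upper_part_corner// mxE !eqxx scale1r.
  by rewrite eZ -ee scalerAl -eZ -mulrA uZe mulr0.
rewrite /block_structure.
have -> : \tr (Q * (Q * Z - Z * Q)) = 0.
  rewrite mulrBr mxtraceB [Q * (Z * Q)]mulrA -!mulmxE.
  by rewrite [\tr (Q *m Z *m Q)]mxtrace_mulC subrr.
have -> : upper (Q * Z - Z * Q) = Q * upper Z - upper Z * Q.
  by rewrite linearB /= upper_part_mull// upper_part_mulr.
rewrite scale0r subr0.
move: uZe euZ; set W := upper Z => uZe euZ.
rewrite !(mulrBr, mulrBl, mulrDl, mulNr, mulrN, opprK) -?scalerAl -?scalerAr -!mulrA.
rewrite ?(QQmull, Qemull, eQmull, Qe, eQ) QQ !(mulrBr, mulr1).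
have YeX : Y * (e * X) = 0 by rewrite mulrA Ye mul0r.
rewrite /Z -?mulrA ?Ye YeX ?uZe ?euZ !(mul0r, mulr0, scaler0).
apply/matrixP => i j.
move: (Q * (X * (Y * Q))) (e * (Y * Q)) (Y * X) (X * Y) (Q * (W * Q)) => a b c d f.
by rewrite !mxE; ring.
Qed.

(** The tensor is biadditive and antisymmetric, so splitting both arguments into upper and lower
    parts leaves the three cases above. *)
Lemma nijenhuis_block_structure A B : nijenhuis_tensor (J Q) A B = 0.
Proof.
have uu Z := upper_part_id lev Z; have ul Z := upper_part_low lev Z.
have N_upper Z W : upper Z = Z -> nijenhuis_tensor (J Q) Z W = 0.
  move=> uZ; rewrite -[W](subrK (upper W)) nijenhuis_tensorDr.
  by rewrite nijenhuis_upper_lower// nijenhuis_upper// addr0.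
have N_lower Z W : upper Z = 0 -> nijenhuis_tensor (J Q) Z W = 0.
  move=> lZ; rewrite -[W](subrK (upper W)) nijenhuis_tensorDr.
  by rewrite nijenhuis_lower// nijenhuis_tensorC N_upper// oppr0 addr0.
rewrite nijenhuis_tensorC -[A](subrK (upper A)) nijenhuis_tensorDr.
rewrite ![nijenhuis_tensor _ B _]nijenhuis_tensorC.
by rewrite (N_upper (upper A))// N_lower// oppr0 addr0 oppr0.
Qed.

End BlockStructures.

(** * Quaternion units *)

Section PairedIndices.
Context {F : fieldType} {k : nat}.
Local Notation N := k.*2.+1.
Local Notation M := 'M[F]_N.
Variable iota : F.
Hypothesis iota2 : iota * iota = -1.
Implicit Types (i j : 'I_N) (X : M).

(** The indices 2l and 2l+1 share level l; the last index 2k is alone at level k. *)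
Definition level i : nat := i./2.

(** The other member of the pair. At the last index the successor is out of range and [inord]
    returns a default, which [unit_J] masks. *)
Definition partner i : 'I_N := inord (if odd i then i.-1 else i.+1).

Definition unit_I : M :=
  \matrix_(i, j) if (i != ord_max) && (j == i) then (-1) ^+ odd i * iota else 0.

Definition unit_J : M :=
  \matrix_(i, j) if (i != ord_max) && (j == partner i) then (-1) ^+ odd i else 0.

Lemma level_max i : i != ord_max -> (level i < level ord_max)%N.
Proof.
move=> im; rewrite /level /= half_double ltn_half_double.
by have := ltn_ord i; rewrite ltnS leq_eqVlt; case: eqP => // e; move: im;
  rewrite -val_eqE /= e eqxx.
Qed.

Lemma val_partner i : i != ord_max ->
  partner i = (if odd i then i.-1 else i.+1) :> nat.
Proof.
move=> im; rewrite /partner inordK//.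
have := level_max im; rewrite /level /= half_double ltn_half_double => ik.
case: ifP => [_|/negbT oi]; first by rewrite ltnS (leq_trans (leq_pred _)) // ltnW.
by rewrite ltnS.
Qed.

Lemma odd_partner i : i != ord_max -> odd (partner i) = ~~ odd i.
Proof.
move=> im; rewrite val_partner//; case: ifP => [oi|/= -> //].
by case: (nat_of_ord i) oi => //= l /negbTE.
Qed.

Lemma partner_max i : i != ord_max -> partner i != ord_max.
Proof.
move=> im; rewrite -val_eqE /= val_partner//.
have := level_max im; rewrite /level /= half_double ltn_half_double => ik.
case: ifP => [_|oi]; first by rewrite ltn_eqF// (leq_ltn_trans (leq_pred _)).
(* The successor of an even index is odd, unlike the last index 2k. *)
by apply/eqP => e; have := odd_double k; rewrite -e /= oi.
Qed.

Lemma partnerK i : i != ord_max -> partner (partner i) = i.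
Proof.
move=> im; apply: val_inj.
rewrite /= val_partner ?partner_max// odd_partner// val_partner//.
by case: (boolP (odd i)) => //=; case: (nat_of_ord i).
Qed.

Lemma level_partner i : i != ord_max -> level (partner i) = level i.
Proof.
move=> im; rewrite /level val_partner//.
case: ifP => [|/negbT oi].
  by case: (nat_of_ord i) => //= l /negbTE ol; rewrite uphalf_half ol.
by rewrite /= uphalf_half (negbTE oi).
Qed.

Lemma unit_I_mull X i j : (unit_I * X) i j =
  if i != ord_max then (-1) ^+ odd i * iota * X i j else 0.
Proof.
rewrite !mxE (bigD1 i)//= big1 ?addr0.
  by rewrite !mxE eqxx andbT; case: ifP => //; rewrite mul0r.
by move=> l li; rewrite !mxE (negbTE li) andbF mul0r.
Qed.

Lemma unit_J_mull X i j : (unit_J * X) i j =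
  if i != ord_max then (-1) ^+ odd i * X (partner i) j else 0.
Proof.
rewrite !mxE (bigD1 (partner i))//= big1 ?addr0.
  by rewrite !mxE eqxx andbT; case: ifP => //; rewrite mul0r.
by move=> l li; rewrite !mxE (negbTE li) andbF mul0r.
Qed.

Lemma unit_I_block : block_diagonal level unit_I.
Proof.
move=> i j ij; rewrite mxE; case: ifP => // /andP[_ /eqP ji].
by rewrite ji eqxx in ij.
Qed.

Lemma unit_J_block : block_diagonal level unit_J.
Proof.
move=> i j ij; rewrite mxE; case: ifP => // /andP[im /eqP ji].
by rewrite ji level_partner ?eqxx in ij.
Qed.

Lemma unit_I_corner : unit_I * corner = 0.
Proof.
apply/matrixP => i j; rewrite unit_I_mull !mxE.
by case: eqP => //=; rewrite mulr0.
Qed.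

Lemma unit_J_corner : unit_J * corner = 0.
Proof.
apply/matrixP => i j; rewrite unit_J_mull !mxE.
by case: ifP => // im; rewrite (negbTE (partner_max im)) mulr0.
Qed.

Lemma block_diagonal_upper (Q : M) :
  block_diagonal level Q -> upper_part level Q = Q.
Proof.
move=> bQ; apply/matrixP => i j; rewrite mxE; case: leqP => // ji.
by rewrite bQ// gtn_eqF.
Qed.

Lemma corner_unit_I : corner * unit_I = 0.
Proof.
rewrite (corner_upper level_max) ?mxE ?eqxx ?scale0r//.
exact/block_diagonal_upper/unit_I_block.
Qed.

Lemma corner_unit_J : corner * unit_J = 0.
Proof.
rewrite (corner_upper level_max) ?mxE ?eqxx ?scale0r//.
exact/block_diagonal_upper/unit_J_block.
Qed.

Lemma unit_I_sqr : unit_I * unit_I = corner - 1.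
Proof.
apply/matrixP => i j; rewrite unit_I_mull !mxE.
case: eqP => [->|_] /=; first by rewrite [j == _]eq_sym subrr.
rewrite sub0r eq_sym; case: eqP => /= _; last by rewrite mulr0 oppr0.
by rewrite mulrACA iota2 -expr2 sqrr_sign mul1r.
Qed.

(** The partner has opposite parity, so the two signs met on the way back to [i] multiply to -1. *)
Lemma unit_J_sqr : unit_J * unit_J = corner - 1.
Proof.
apply/matrixP => i j; rewrite unit_J_mull !mxE.
case: (eqVneq i ord_max) => [->|im] /=; first by rewrite [j == _]eq_sym subrr.
rewrite partner_max// partnerK// odd_partner// sub0r eq_sym.
case: eqP => /= _; last by rewrite mulr0 oppr0.
by case: (odd i); rewrite /= ?expr0 ?expr1 ?mulr1 ?mul1r.
Qed.

(** Passing from an index to its partner flips the sign of the diagonal entry of [unit_I]. *)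
Lemma unit_IJ : unit_I * unit_J = - (unit_J * unit_I).
Proof.
apply/matrixP => i j; rewrite unit_I_mull [RHS]mxE unit_J_mull !mxE.
case: (eqVneq i ord_max) => [->|im] /=; first by rewrite oppr0.
rewrite partner_max// odd_partner//=.
case: eqP => /= _; last by rewrite !mulr0 oppr0.
by case: (odd i); rewrite /= ?expr0 ?expr1 ?mulr1 ?mul1r ?mulN1r ?mulNr ?mul1r
  ?mulrN1 ?opprK.
Qed.

End PairedIndices.

(* The value at the identity of a left-invariant complex structure on SL_n(C).
   Outside sl_n the map j is only required to land in sl_n, so j^3 = - j. *)
Record sl_complex_structure (F : fieldType) n (j : 'M[F]_n -> 'M[F]_n) : Prop := {
  sl_trace : forall A, \tr (j A) = 0;
  sl_sqr : forall A, \tr A = 0 -> j (j A) = - A;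
  sl_nijenhuis : forall A B,
    (j A *m j B - j B *m j A) - (A *m B - B *m A)
    - j (j A *m B - B *m j A) - j (A *m j B - j B *m A) = 0 }.

Lemma exists_sl_hypercomplex (F : fieldType) (iota : F) k :
  iota * iota = -1 ->
  exists j1 j2 : {linear 'M[F]_(k.*2.+1) -> 'M[F]_(k.*2.+1)},
    [/\ sl_complex_structure j1, sl_complex_structure j2 &
        forall A, j1 (j2 A) = - j2 (j1 A)].
Proof.
move=> iota2.
exists (block_structure (@level k) (unit_I iota)),
  (block_structure (@level k) unit_J).
have lm := @level_max k.
have bI := unit_I_block (k := k) iota; have bJ := @unit_J_block F k.
have Ie := unit_I_corner (k := k) iota; have Je := @unit_J_corner F k.
have II := unit_I_sqr (k := k) iota2; have JJ := @unit_J_sqr F k.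
split; [split=> [A|A tA|A B] /=..|move=> A /=].
- exact: mxtrace_block_structure.
- by rewrite (block_structure_sqr lm) ?tA ?scale0r ?addr0.
- by apply: (nijenhuis_block_structure lm) => //; exact: corner_unit_I.
- exact: mxtrace_block_structure.
- by rewrite (block_structure_sqr lm) ?tA ?scale0r ?addr0.
- by apply: (nijenhuis_block_structure lm) => //; exact: corner_unit_J.
- by apply: block_structure_anticomm => //; exact: unit_IJ.
Qed.

(** * Tangent vectors of SL_n(C) *)

Section Tangent.
Context {R : realType}.

Lemma derive_curve (V W : normedModType R) (F : V -> W) (c : R^o -> V) (t : R^o) :
  differentiable c t -> differentiable F (c t) ->
  'D_1 (F \o c) t = 'D_('D_1 c t) F (c t).
Proof.
move=> dc dF; rewrite (deriveE _ dF) (deriveE _ dc) deriveE.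
  by rewrite (diff_comp dc dF).
exact: differentiable_comp.
Qed.

(** For a curve c in M with velocity v, every extension has derivative (f o c)'(0) along v, a value
    that mentions [f] on M only. *)
Lemma tdiffE (V W : normedModType R) (M : set V) (f F : V -> W) (p v : V) :
  tangent M p v -> local_extension M f p F -> tdiff M f p v = 'D_v F p.
Proof.
move=> [c [I [I0 [oI Ic] cM c0 vE]]] extF.
have dc : differentiable c (0 : R^o) by have [+ _] := Ic 1%N; exact.
have along (F' : V -> W) : local_extension M f p F' ->
    'D_v F' p = 'D_1 (f \o c) (0 : R^o).
  move=> [U [Up [oU sU] UM]].
  have dF' : differentiable F' (c 0) by rewrite c0; have [+ _] := sU 1%N; exact.
  rewrite -vE -{1}c0 -derive_curve//; apply: near_eq_derive.
  have nI : nbhs (0 : R^o) I by exact: open_nbhs_nbhs.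
  have nU : nbhs (0 : R^o) (c @^-1` U).
    apply: (differentiable_continuous dc); rewrite c0.
    exact: open_nbhs_nbhs.
  by apply: filterS2 nI nU => t It Ut; exact/UM/cM.
rewrite (along _ extF) /tdiff.
(* The default 0 of [xget] is excluded because [F] makes the set nonempty. *)
have [F' extF' <-] : [set w | exists2 F0, local_extension M f p F0 & 'D_v F0 p = w]
    (xget 0 [set w | exists2 F0, local_extension M f p F0 & 'D_v F0 p = w]).
  by apply: xgetPex; exists ('D_v F p), F.
exact: along.
Qed.

End Tangent.

Section SpecialLinear.
Context {R : realType} {n : nat}.
Local Notation C := R[i].
Local Notation V := ('M[R]_n * 'M[R]_n)%type.
Local Notation G := (@SLC R n).
Local Notation tc := (@to_complex R n).
Local Notation oc := (@of_complex R n).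
Implicit Types (p q v w : V).

Lemma SL_mul_adj p : G p -> tc p *m \adj (tc p) = 1%:M.
Proof. by rewrite /SLC /= mul_mx_adj => ->. Qed.

Lemma SL_adj_mul p : G p -> \adj (tc p) *m tc p = 1%:M.
Proof. by rewrite /SLC /= mul_adj_mx => ->. Qed.

(** Along a curve c in the group, adj(p) c(t) has constant determinant 1 and is the identity at t =
    0, where the derivative of the determinant is the trace. *)
Lemma tangent_SL_trace p v : G p -> tangent G p v ->
  \tr (\adj (tc p) *m tc v) = 0.
Proof.
move=> Gp [c [I [I0 [oI Ic] cM c0 vE]]].
have dc : differentiable c (0 : R^o) by have [+ _] := Ic 1%N; exact.
have [dtc vtc] := differentiable_to_complex (1 : R^o) dc.
pose A (t : R^o) := \adj (tc p) *m (tc \o c) t.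
have dA : Mdifferentiable A (0 : R^o).
  by apply: MdifferentiableM => //; exact: Mdifferentiable_cst.
have A0 : A 0 = 1%:M by rewrite /A /= c0 SL_adj_mul.
have det_adj : \det (\adj (tc p)) = 1.
  have := congr1 determinant (SL_mul_adj Gp).
  by rewrite det_mulmx det1 (Gp : \det (tc p) = 1) mul1r.
have <- : Mderive (1 : R^o) A (0 : R^o) = \adj (tc p) *m tc v.
  rewrite /A MderiveM//.
  by rewrite Mderive_cst mul0mx add0r -vtc vE.
rewrite -Cderive_det1// -[RHS](Cderive_cst (1 : C) (1 : R^o) (0 : R^o)).
apply: Cderive_near_eq.
have nI : nbhs (0 : R^o) I by exact: open_nbhs_nbhs.
apply: filterS nI => t It; rewrite /A det_mulmx det_adj mul1r.
exact: (cM t It).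
Qed.

Lemma Cderive_line (a b : C) :
  (forall k U, open U -> CCk k U (fun t : R^o => a + Complex t 0 * b)) /\
  Cderive (1 : R^o) (fun t : R^o => a + Complex t 0 * b) (0 : R^o) = b.
Proof.
have ht k U : CCk k U (fun t : R^o => Complex t 0 : C).
  by split; [exact: Ck_on_open_id|exact: Ck_on_open_cst].
have oT : open [set: R^o] by exact: openT.
have dt : Cdifferentiable (fun t : R^o => Complex t 0 : C) (0 : R^o).
  exact: (@CCk_differentiable _ _ 0 setT).
split=> [k U oU|].
  apply: CCkD => //; first exact: CCk_cst.
  by apply: CCkM => //; exact: CCk_cst.
rewrite CderiveD; last 2 first.
- exact: Cdifferentiable_cst.
- by apply: CdifferentiableM => //; exact: Cdifferentiable_cst.
rewrite Cderive_cst add0r CderiveM//.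
rewrite Cderive_cst mulr0 addr0 [X in X * _](_ : _ = 1) ?mul1r//.
by congr Complex; [exact: derive_id|exact: derive_cst].
Qed.

Hypothesis n_gt0 : (0 < n)%N.

Let i0 : 'I_n := Ordinal n_gt0.

(* The curve p S(t) (1 + t X), where S(t) divides the first row by
   det (1 + t X); the latter has derivative tr X = 0 at t = 0. *)
Lemma SL_tangent p v : G p -> \tr (\adj (tc p) *m tc v) = 0 -> tangent G p v.
Proof.
move=> Gp; set X := \adj (tc p) *m tc v => trX.
pose B (t : R^o) : 'M[C]_n := \matrix_(i, j) (1%:M i j + Complex t 0 * X i j).
pose d t := \det (B t).
have hB k U : open U -> MCk k U B.
  move=> oU i j; under eq_fun do rewrite mxE.
  by have [+ _] := Cderive_line (1%:M i j) (X i j); exact.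
have dB : Mderive (1 : R^o) B (0 : R^o) = X.
  apply/matrixP => i j; rewrite mxE; under eq_fun do rewrite mxE.
  by have [_ ->] := Cderive_line (1%:M i j) (X i j).
have B0 : B 0 = 1%:M.
  by apply/matrixP => i j; rewrite mxE [Complex 0 0 * _]mul0r addr0.
have hd k U : open U -> CCk k U d by move=> oU; apply: CCk_det => //; exact: hB.
pose I : set R^o := [set t | d t != 0].
have d0 : d 0 = 1 by rewrite /d B0 det1.
have I0 : I 0 by rewrite /I /= d0 oner_neq0.
have oI : open I.
  (* Nonvanishing of [d] is nonvanishing of its squared modulus, a continuous real function. *)
  pose g t : R^o := complex.Re (d t) * complex.Re (d t) +
    complex.Im (d t) * complex.Im (d t).
  have cg : continuous g.
    have [hr hi] := hd 0%N setT openT.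
    have hg : Ck_on_open 0 setT g.
      exact: Ck_on_openD openT (Ck_on_openM openT hr hr) (Ck_on_openM openT hi hi).
    by move=> t; exact: hg.
  have -> : I = g @^-1` [set~ 0].
    apply/seteqP; split=> t; rewrite /I /g /= -!expr2.
      move=> + /eqP; rewrite paddr_eq0 ?sqr_ge0// !sqrf_eq0 => /negP + h; apply.
      by rewrite eq_complex.
    move=> h; apply/eqP => dt; apply: h.
    by rewrite dt /= expr0n /= addr0.
  by apply: open_comp => [t _|]; [exact: cg|rewrite openC; exact: closed_eq].
pose s t : C := (d t)^-1.
have hs k : CCk k I s by apply: CCkV => //; exact: hd.
pose S t : 'M[C]_n :=
  \matrix_(i, j) if i == j then if i == i0 then s t else 1 else 0.
have hS k : MCk k I S.
  move=> i j; under eq_fun do rewrite mxE.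
  by case: (i == j); case: (i == i0) => //; exact: CCk_cst.
have S0 : S 0 = 1%:M.
  apply/matrixP => i j; rewrite !mxE /s d0 invr1.
  by case: ifP => //; case: ifP.
have detS t : \det (S t) = s t.
  have -> : S t = diag_mx (\row_j if j == i0 then s t else 1).
    by apply/matrixP => i j; rewrite !mxE; case: eqP => [->|].
  rewrite det_diag (bigD1 i0)//= mxE eqxx big1 ?mulr1// => j ji.
  by rewrite mxE (negbTE ji).
have dd : Cdifferentiable d (0 : R^o) := CCk_differentiable (hd 1%N _ oI) I0.
have ds : Cdifferentiable s (0 : R^o) := CCk_differentiable (hs 1%N) I0.
have Dd : Cderive (1 : R^o) d (0 : R^o) = 0.
  rewrite /d Cderive_det1 ?dB//.
  exact: MCk_differentiable (hB 1%N _ oI) I0.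
have Ds : Cderive (1 : R^o) s (0 : R^o) = 0.
  (* Differentiating d s = 1 at 0, where d = 1 and d' = 0, gives s' = 0. *)
  have : Cderive (1 : R^o) (fun t => d t * s t) (0 : R^o) = 0.
    rewrite -[RHS](Cderive_cst (1 : C) (1 : R^o) (0 : R^o)).
    apply: Cderive_near_eq.
    have nI : nbhs (0 : R^o) I by exact: open_nbhs_nbhs.
    by apply: filterS nI => t It; rewrite /s divff.
  by rewrite CderiveM// Dd mul0r add0r d0 mul1r.
have DS : Mderive (1 : R^o) S (0 : R^o) = 0.
  apply/matrixP => i j; rewrite [LHS]mxE [RHS]mxE; under eq_fun do rewrite mxE.
  by case: (i == j); case: (i == i0) => //; exact: Cderive_cst.
pose A t := tc p *m (S t *m B t).
have hA k : MCk k I A.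
  apply: MCkM => //; first exact: MCk_cst.
  by apply: MCkM => //; exact: hB.
have dS1 := MCk_differentiable (hS 1%N) I0.
have dB1 := MCk_differentiable (hB 1%N _ oI) I0.
exists (oc \o A), I; split=> //.
- by split=> // k; exact: Ck_of_complex.
- move=> t It; rewrite /SLC /= of_complexK /A !det_mulmx detS.
  by rewrite (Gp : \det (tc p) = 1) mul1r mulVf.
- by rewrite /= /A S0 B0 !mulmx1 to_complexK.
- rewrite (derive_of_complex _ oI I0 (hA 1%N)) /A.
  rewrite MderiveM; [|exact: Mdifferentiable_cst|exact: MdifferentiableM].
  rewrite Mderive_cst mul0mx add0r MderiveM// DS mul0mx add0r dB S0 mul1mx.
  by rewrite /X mulmxA SL_mul_adj// mul1mx to_complexK.
Qed.

End SpecialLinear.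

(** * Left-invariant structures *)

Section LeftInvariantStructure.
Context {R : realType} {n : nat}.
Local Notation C := R[i].
Local Notation V := ('M[R]_n * 'M[R]_n)%type.
Local Notation G := (@SLC R n).
Local Notation tc := (@to_complex R n).
Local Notation oc := (@of_complex R n).
Implicit Types (p q v w : V).
Hypothesis n_gt0 : (0 < n)%N.

Lemma of_complexP (x y : V) : tc x = tc y -> x = y.
Proof. exact: (can_inj to_complexK). Qed.

(* p^-1 is replaced by the adjugate of p, so that the formula is polynomial. *)
Definition left_translate (j : 'M[C]_n -> 'M[C]_n) p v : V :=
  oc (tc p *m j (\adj (tc p) *m tc v)).

(** [xi] is the field read in the left trivialization of the tangent bundle, smooth on an open set
    of matrices; it has to reproduce [X] on the group only. *)
Definition left_trivialized (X : V -> V) (U : set V) (xi : V -> 'M[C]_n) : Prop :=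
  [/\ open U, forall k, MCk k U xi &
      forall q, U q -> G q -> X q = oc (tc q *m xi q)].

Lemma Mderive_to_complex v p : Mdifferentiable tc p /\ Mderive v tc p = tc v.
Proof.
have did : differentiable (@id V) p by exact: ex_diff.
have [h1 h2] := differentiable_to_complex v did.
by split=> //; rewrite -[RHS](congr1 tc (derive_id p v)) h2.
Qed.

Lemma MCk_to_complex U k : open U -> MCk k U tc.
Proof. by move=> oU; exact: Ck_to_complex oU (Ck_on_open_id U k). Qed.

Lemma tdiff_left_trivialized X U xi p v : left_trivialized X U xi -> U p ->
  tangent G p v ->
  tdiff G X p v = oc (tc v *m xi p + tc p *m Mderive v xi p).
Proof.
move=> [oU sxi Xxi] Up tv.
have hk k : MCk k U (fun q => tc q *m xi q).
  by apply: MCkM => //; exact: MCk_to_complex.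
rewrite (@tdiffE _ _ _ _ _ (oc \o (fun q => tc q *m xi q)) _ _ tv); last first.
  exists U; split=> //; last by move=> q Uq Gq; rewrite Xxi.
  by split=> // k; exact: Ck_of_complex.
rewrite (derive_of_complex v oU Up (hk 1%N)).
have [dtc Dtc] := Mderive_to_complex v p.
by rewrite (MderiveM _ dtc (MCk_differentiable (sxi 1%N) Up)) Dtc.
Qed.

(** By the Leibniz rule for q xi(q), differentiating the factor q yields the commutator, and
    differentiating [xi] and [eta] the other two terms. *)
Lemma lie_bracket_left_trivialized X Y U U' xi eta p :
  left_trivialized X U xi -> left_trivialized Y U' eta -> U p -> U' p -> G p ->
  tangent G p (X p) -> tangent G p (Y p) ->
  tc (lie_bracket G X Y p) = tc p *m
    (xi p *m eta p - eta p *m xi p + Mderive (X p) eta p - Mderive (Y p) xi p).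
Proof.
move=> hX hY Up U'p Gp tX tY; rewrite /lie_bracket.
rewrite (tdiff_left_trivialized hY U'p tX) (tdiff_left_trivialized hX Up tY).
have [_ _ ->] // := hX; have [_ _ ->] // := hY.
rewrite to_complexB !of_complexK -!mulmxA -!mulmxDr -mulmxBr; congr (_ *m _).
by rewrite opprD addrACA addrA.
Qed.

Variable j : {linear 'M[C]_n -> 'M[C]_n}.
Hypothesis sl_j : sl_complex_structure j.
Local Notation J := (left_translate j).

Lemma tangent_left_translate p v : G p -> tangent G p (J p v).
Proof.
move=> Gp; apply: SL_tangent => //.
by rewrite of_complexK mulmxA SL_adj_mul// mul1mx (sl_trace sl_j).
Qed.

Lemma left_translate_mul p A : G p -> tc (J p (oc (tc p *m A))) = tc p *m j A.
Proof. by move=> Gp; rewrite !of_complexK mulmxA SL_adj_mul// mul1mx. Qed.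

Lemma smooth_left_translate :
  smooth_on (tangent_bundle G) (fun x : V * V => (x.1, J x.1 x.2)).
Proof.
(* The formula with the adjugate is polynomial on all pairs of matrices, so it is its own global
   extension. *)
move=> x _; exists (fun x : V * V => (x.1, J x.1 x.2)), setT; split=> //.
have oT : open [set: V * V] by exact: openT.
split=> // k.
have h1 : Ck_on_open k setT (fst : V * V -> V).
  apply: (Ck_on_open_linear oT (L := fst)) (Ck_on_open_id _ k) => //.
  by move=> y; exact: cvg_fst.
have h2 : Ck_on_open k setT (snd : V * V -> V).
  apply: (Ck_on_open_linear oT (L := snd)) (Ck_on_open_id _ k) => //.
  by move=> y; exact: cvg_snd.
apply: Ck_on_open_pair => //.
apply: (Ck_of_complex oT); apply: MCkM => //; first exact: Ck_to_complex oT h1.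
apply: (MCk_linear j oT); apply: MCkM => //; last exact: Ck_to_complex oT h2.
exact: MCk_adj oT (Ck_to_complex oT h1).
Qed.

Lemma bundle_endomorphism_left_translate : bundle_endomorphism G J.
Proof.
split=> [p v Gp _|p a u v _ _ _|]; [exact: tangent_left_translate| |].
  apply: of_complexP; rewrite to_complexD to_complexZ [LHS]of_complexK.
  rewrite [X in _ = _ *: X + _]of_complexK [X in _ = _ + X]of_complexK.
  rewrite to_complexD to_complexZ mulmxDr -scalemxAr linearP /=.
  by rewrite mulmxDr -scalemxAr.
exact: smooth_left_translate.
Qed.

Lemma left_translate_sqr p v : G p -> tangent G p v -> J p (J p v) = - v.
Proof.
move=> Gp tv; apply: of_complexP; rewrite left_translate_mul//.
rewrite (sl_sqr sl_j) ?tangent_SL_trace// mulmxN mulmxA SL_mul_adj// mul1mx.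
by rewrite to_complexN.
Qed.

Lemma left_invariant_left_translate : left_invariant G (@cmul R n) J.
Proof.
move=> g p v Gg Gp tv.
have lg : linear (cmul g).
  move=> a x y; apply: of_complexP; rewrite to_complexD to_complexZ !of_complexK.
  by rewrite to_complexD to_complexZ mulmxDr scalemxAr.
have oT : open [set: V] by exact: openT.
have hk k : MCk k setT (fun q => tc g *m tc q).
  by apply: MCkM => //; [exact: MCk_cst|exact: MCk_to_complex].
(* Left translation is the restriction of a linear map of matrices, hence its own differential. *)
have tdg w : tangent G p w -> tdiff G (cmul g) p w = cmul g w.
  move=> tw; rewrite (@tdiffE _ _ _ _ _ (cmul g) _ _ tw).
    rewrite (derive_of_complex w oT Logic.I (hk 1%N)).
    have [dtc Dtc] := Mderive_to_complex w p.
    rewrite MderiveM// Dtc.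
    by rewrite Mderive_cst mul0mx add0r.
  by exists setT; split=> //; split=> // k; exact: Ck_of_complex.
rewrite !tdg//; last exact: tangent_left_translate.
apply: of_complexP; rewrite !of_complexK -mulmxA; congr (_ *m (_ *m j _)).
(* On the group the adjugate is the inverse, and (g p)^-1 g = p^-1. *)
have adjg : \adj (tc g *m tc p) *m tc g = \adj (tc p).
  have gp1 : \adj (tc g *m tc p) *m (tc g *m tc p) = 1%:M.
    rewrite mul_adj_mx det_mulmx (Gg : \det (tc g) = 1) (Gp : \det (tc p) = 1).
    by rewrite mulr1.
  rewrite -[LHS]mulmx1 -(SL_mul_adj Gp) !mulmxA -[X in X *m \adj _]mulmxA.
  by rewrite gp1 mul1mx.
by rewrite [RHS]mulmxA adjg.
Qed.

Lemma vector_field_left_trivialized X p : vector_field G X -> G p ->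
  exists U xi, [/\ left_trivialized X U xi, U p & forall q, \tr (xi q) = 0].
Proof.
move=> [sX tX] Gp; have [F [U [Up [oU sF] FX]]] := sX p Gp.
pose W q := \adj (tc q) *m tc (F q).
have hW k : MCk k U W.
  apply: MCkM => //; last exact: Ck_to_complex.
  by apply: MCk_adj => //; exact: MCk_to_complex.
(* Off the group [W q] may have nonzero trace. The operator - j^2 lands in sl_n and is the identity
   on it, so it makes [xi] traceless on the whole open set without changing it on the group;
   derivatives of [xi] are then traceless in every direction. *)
exists U, (fun q => - j (j (W q))); split=> //.
  split=> //.
    move=> k; have h := MCk_linear j oU (MCk_linear j oU (hW k)).
    have hN := MCkM oU (MCk_cst U (-1)%:M k) h.
    by apply: MCk_eq hN => // q _; rewrite /cst mul_scalar_mx scaleN1r.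
  move=> q Uq Gq; rewrite (sl_sqr sl_j) ?opprK.
    by rewrite /W mulmxA SL_mul_adj// mul1mx FX// to_complexK.
  by rewrite /W FX//; apply: tangent_SL_trace => //; exact: tX.
by move=> q; rewrite mxtraceN (sl_trace sl_j) oppr0.
Qed.

Lemma left_trivialized_left_translate X U xi : left_trivialized X U xi ->
  left_trivialized (fun q => J q (X q)) U (fun q => j (xi q)).
Proof.
move=> [oU sxi Xxi]; split=> // [k|q Uq Gq]; first exact: MCk_linear.
by apply: of_complexP; rewrite Xxi// left_translate_mul// of_complexK.
Qed.

Lemma mxtrace_Mderive U xi p v : open U -> U p -> MCk 1 U xi ->
  (forall q, \tr (xi q) = 0 :> C) -> \tr (Mderive v xi p : 'M[C]_n) = 0.
Proof.
move=> oU Up sxi tr0; have d := MCk_differentiable sxi Up.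
rewrite /mxtrace; under eq_bigr do rewrite mxE.
rewrite -Cderive_sum// -[RHS](Cderive_cst (0 : C) v p).
by congr Cderive; apply/funext => q; exact: tr0.
Qed.

(** Here [a] and [b] are the values of [xi] and [eta]; [d1], [d3] are the derivatives of [eta] along
    JX, X and [d2], [d4] those of [xi] along JY, Y. The terms j d1 and j d2 cancel outright, those
    in d3 and d4 by j^2 = -1 on sl_n, and the algebraic tensor remains. *)
Lemma nijenhuis_with_derivatives (a b d1 d2 d3 d4 e1 e2 e3 e4 : 'M[C]_n) :
  e1 = j d1 -> e2 = j d2 -> e3 = j d3 -> e4 = j d4 -> \tr d3 = 0 -> \tr d4 = 0 ->
  (j a *m j b - j b *m j a + e1 - e2) - (a *m b - b *m a + d3 - d4)
  - j (j a *m b - b *m j a + d1 - e4) - j (a *m j b - j b *m a + e3 - d2) = 0.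
Proof.
move=> -> -> -> -> /(sl_sqr sl_j) jj3 /(sl_sqr sl_j) jj4; have N := sl_nijenhuis sl_j a b.
rewrite !(linearB j, linearD j) /= jj3 jj4.
rewrite !(linearB j) /= in N.
rewrite -[RHS]N; apply/matrixP => r s.
move: (j (j a *m b)) (j (b *m j a)) (j (a *m j b)) (j (j b *m a)) (j d1) (j d2).
move: (j a *m j b) (j b *m j a) (a *m b) (b *m a).
move=> p1 p2 p3 p4 q1 q2 q3 q4 jd1 jd2.
by rewrite !mxE; ring.
Qed.

Lemma integrable_left_translate : integrable_structure G J.
Proof.
move=> X Y vX vY JX JY p Gp.
have [U [xi [hX Up txi]]] := vector_field_left_trivialized vX Gp.
have [U' [eta [hY U'p teta]]] := vector_field_left_trivialized vY Gp.
have hJX := left_trivialized_left_translate hX.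
have hJY := left_trivialized_left_translate hY.
have tX : tangent G p (X p) by case: vX => _; exact.
have tY : tangent G p (Y p) by case: vY => _; exact.
have tJX : tangent G p (JX p) by exact: tangent_left_translate.
have tJY : tangent G p (JY p) by exact: tangent_left_translate.
have [oU sxi _] := hX; have [oU' seta _] := hY.
have dxi := MCk_differentiable (sxi 1%N) Up.
have deta := MCk_differentiable (seta 1%N) U'p.
have Jtc A B : tc A = tc p *m B -> tc (J p A) = tc p *m j B.
  by move=> AB; rewrite -(left_translate_mul _ Gp) -AB to_complexK.
(* All four brackets have the form p B and J acts on them through j, so p factors out and an
   identity between the matrices B remains. *)
have combine b1 b2 b3 b4 B1 B2 B3 B4 : tc b1 = tc p *m B1 -> tc b2 = tc p *m B2 ->
    tc b3 = tc p *m B3 -> tc b4 = tc p *m B4 -> B1 - B2 - j B3 - j B4 = 0 ->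
    b1 - b2 - J p b3 - J p b4 = 0.
  move=> e1 e2 /Jtc e3 /Jtc e4 B0; apply: of_complexP.
  rewrite 3!to_complexB e1 e2 e3 e4 -!mulmxBr B0 mulmx0.
  by apply/matrixP => a b; rewrite !mxE.
apply: (combine _ _ _ _ _ _ _ _
  (lie_bracket_left_trivialized hJX hJY Up U'p Gp tJX tJY)
  (lie_bracket_left_trivialized hX hY Up U'p Gp tX tY)
  (lie_bracket_left_trivialized hJX hY Up U'p Gp tJX tY)
  (lie_bracket_left_trivialized hX hJY Up U'p Gp tX tJY)).
have De w := Mderive_linear j w deta; have Dx w := Mderive_linear j w dxi.
apply: (nijenhuis_with_derivatives _ _ (De _) (Dx _) (De _) (Dx _)).
  exact: mxtrace_Mderive oU' U'p (seta 1%N) teta.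
exact: mxtrace_Mderive oU Up (sxi 1%N) txi.
Qed.

Lemma complex_structure_left_translate : complex_structure G J.
Proof.
split; [exact: bundle_endomorphism_left_translate|exact: left_translate_sqr|].
exact: integrable_left_translate.
Qed.

End LeftInvariantStructure.

(** * Homogeneous hypercomplex structures on SL(2m-1, C) *)

Theorem corollary1p3 (R : realType) (m : nat) (hm : (1 < m)%N) :
  exists J1 J2 : 'M[R]_(2 * m - 1) * 'M[R]_(2 * m - 1) ->
      'M[R]_(2 * m - 1) * 'M[R]_(2 * m - 1) ->
      'M[R]_(2 * m - 1) * 'M[R]_(2 * m - 1),
    homogeneous_hypercomplex_structure
      (@SLC R (2 * m - 1)) (@cmul R (2 * m - 1)) J1 J2.
Proof.
(* The indices form m - 1 pairs and a last one; the square root of -1 is the complex unit. *)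
have -> : (2 * m - 1)%N = m.-1.*2.+1.
  by case: m hm => // k _; rewrite mulnC muln2 doubleS subn1.
have [j1 [j2 [sl1 sl2 j12]]] := exists_sl_hypercomplex m.-1 (sqr_i R).
exists (left_translate j1), (left_translate j2).
split; [|exact: left_invariant_left_translate..].
split; [exact: complex_structure_left_translate..|].
move=> p v Gp _; apply: of_complexP.
rewrite to_complexN !left_translate_mul// j12 mulmxN; congr (- _).
Qed.
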